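(* Let $n$ be a positive integer and let $M$ be the matroid of the type $B$ reflection arrangement $\mathcal B_n$. Then its Chow polynomial is \[H_{\mathcal B_n}(x)=\sum_{(a_1,\dots,a_n)}\left(\prod_{i=1}^n (2a_i-1)\right)x^{\mathrm{des}(a_1,\dots,a_n)}(x+1)^{n-1-2\,\mathrm{des}(a_1,\dots,a_n)},\] where the sum ranges over all tuples $(a_1,\dots,a_n)$ with $a_i\in \{1,\dots,n+1-i\}$ such that $a_1\leq a_2$ and such that $a_i>a_{i+1}$ implies $a_{i-1}\leq a_{i}$ for $i\in\{2,\dots,n-1\}$.
   Context: $\mathcal B_n$ is the arrangement in $\mathbb R^n$ of hyperplanes with normal vectors $e_i\pm e_j$ ($1\le i<j\le n$) and $e_i$ ($1\le i\le n$). Its matroid has ground set $E$ the set of these hyperplanes with rank function $r(S)=n-\dim\bigcap_{H\in S}H$; it is a simple matroid with lattice of flats $\mathcal L(M)$. The Chow ring is $\mathrm{CH}(M)=\mathbb Q[x_F : F\in\mathcal L(M)\setminus\{\emptyset\}]/(I+J)$, where $I$ is generated by $x_{F_1}x_{F_2}$ for incomparable $F_1,F_2\in\mathcal L(M)\setminus\{\emptyset,E\}$ and $J$ is generated by $\sum_{F\ni i}x_F$ for $i\in E$; it is graded with $\deg x_F=1$. The Chow polynomial is $H_M(x)=\sum_{k\ge0}\dim_{\mathbb Q}\mathrm{CH}(M)_k\,x^k$. For a sequence $(a_1,\dots,a_n)$ of integers, $\mathrm{des}(a_1,\dots,a_n)$ is the number of indices $i$ with $a_i>a_{i+1}$. 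*)

(* Defs.v *)
From HB Require Import structures.
From mathcomp Require Import all_boot all_order all_algebra.
From mathcomp Require Import boolp reals.
From mathcomp Require Import mpoly.
From mathcomp Require Import zify.

Set Implicit Arguments.
Unset Strict Implicit.
Unset Printing Implicit Defensive.

Import Order.TTheory GRing.Theory Num.Theory.

Local Open Scope ring_scope.
Local Open Scope quotient_scope.

Record matroid := Matroid {
  ground :> finType;
  rk : {set ground} -> nat;
  rk_le_card : forall S, (rk S <= #|S|)%N;
  rk_mono : forall S T : {set ground}, S \subset T -> (rk S <= rk T)%N;
  rk_submod : forall S T, (rk (S :|: T) + rk (S :&: T) <= rk S + rk T)%N
}.

Definition flat (M : matroid) (F : {set M}) : bool :=
  [forall i, (i \notin F) ==> (rk F < rk (i |: F))%N].

Definition nonempty_flat (M : matroid) : finType :=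
  {F : {set M} | flat F && (F != set0)}.

Section Ideal.

Variable A : comNzRingType.

Definition ideal_gen (gens : seq A) : {pred A} :=
  [pred p | `[< exists c : 'I_(size gens) -> A,
                  p = \sum_i c i * gens`_i >]].

Lemma ideal_genP gens p :
  reflect (exists c : 'I_(size gens) -> A, p = \sum_i c i * gens`_i)
          (p \in ideal_gen gens).
Proof. exact: asboolP. Qed.

Lemma ideal_gen_zmod gens : zmod_closed (ideal_gen gens).
Proof.
split=> [|p q /ideal_genP[c ->] /ideal_genP[d ->]]; apply/ideal_genP.
  by exists (fun=> 0); rewrite big1 // => i _; rewrite mul0r.
exists (fun i => c i - d i); rewrite -sumrB.
by apply: eq_bigr => i _; rewrite mulrBl.
Qed.

Lemma ideal_genM gens a p : p \in ideal_gen gens -> a * p \in ideal_gen gens.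
Proof.
case/ideal_genP=> c ->; apply/ideal_genP; exists (fun i => a * c i).
by rewrite mulr_sumr; apply: eq_bigr => i _; rewrite mulrA.
Qed.

End Ideal.

Section ChowRing.

Variable M : matroid.

Definition chow_poly_ring : comNzRingType :=
  {mpoly rat[#|{: nonempty_flat M}|]}.

Definition chow_var (F : nonempty_flat M) : chow_poly_ring :=
  'X_(enum_rank F).

Definition incomparable (F G : {set M}) : bool :=
  ~~ (F \subset G) && ~~ (G \subset F).

Definition chow_gens_I : seq chow_poly_ring :=
  [seq chow_var P.1 * chow_var P.2 | P <- enum {: nonempty_flat M * nonempty_flat M}
     & [&& val P.1 != [set: M], val P.2 != [set: M]
         & incomparable (val P.1) (val P.2)]].

Definition chow_gens_J : seq chow_poly_ring :=
  [seq \sum_(F : nonempty_flat M | i \in val F) chow_var F | i : M].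

Definition chow_ideal : {pred chow_poly_ring} :=
  ideal_gen (chow_gens_I ++ chow_gens_J).

Lemma chow_gens_const (g : chow_poly_ring) :
  g \in chow_gens_I ++ chow_gens_J -> g@_0%MM = 0.
Proof.
have X0 F : (chow_var F)@_0%MM = 0.
  rewrite /chow_var mcoeffX; case: eqP => // /(congr1 (@mdeg _)).
  by rewrite mdeg1 mdeg0.
rewrite mem_cat => /orP[/mapP[P _ ->]|/mapP[i _ ->]].
  by rewrite rmorphM /= X0 mul0r.
by rewrite raddf_sum /= big1.
Qed.

Lemma chow_ideal_proper :
  1 \notin chow_ideal /\
  (forall a p, p \in chow_ideal -> a * p \in chow_ideal).
Proof.
split=> [|a p]; last exact: ideal_genM.
apply/negP=> /ideal_genP[c /(congr1 (mcoeff 0%MM))] /eqP.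
rewrite mcoeff1 eqxx raddf_sum /= big1 ?oner_eq0 // => i _.
by rewrite rmorphM /= (chow_gens_const (mem_nth _ _)) // mulr0.
Qed.

HB.instance Definition _ := GRing.isZmodClosed.Build chow_poly_ring chow_ideal
  (ideal_gen_zmod _).
HB.instance Definition _ := isProperIdeal.Build chow_poly_ring chow_ideal
  chow_ideal_proper.

Definition chow_ring : Type := {ideal_quot chow_ideal}.
HB.instance Definition _ := GRing.ComNzRing.on chow_ring.

Definition chow_pi : chow_poly_ring -> chow_ring := \pi_{ideal_quot chow_ideal}.

HB.instance Definition _ := GRing.RMorphism.on chow_pi.

Definition chow_scale (q : rat) (c : chow_ring) : chow_ring :=
  chow_pi q%:MP * c.

Fact chow_scaleA a b v : chow_scale a (chow_scale b v) = chow_scale (a * b) v.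
Proof. by rewrite /chow_scale mulrA -rmorphM /= -mpolyCM. Qed.
Fact chow_scale1 : left_id 1 chow_scale.
Proof. by move=> v; rewrite /chow_scale mpolyC1 rmorph1 mul1r. Qed.
Fact chow_scaleDr : right_distributive chow_scale +%R.
Proof. by move=> a u v; rewrite /chow_scale mulrDr. Qed.
Fact chow_scaleDl v : {morph chow_scale^~ v : a b / a + b}.
Proof. by move=> a b; rewrite /chow_scale mpolyCD rmorphD /= mulrDl. Qed.

HB.instance Definition _ := GRing.Zmodule_isLmodule.Build rat chow_ring
  chow_scaleA chow_scale1 chow_scaleDr chow_scaleDl.

Definition chow_piece (k : nat) (c : chow_ring) : Prop :=
  exists2 p : {mpoly rat[#|{: nonempty_flat M}|]},
    p \is k.-homog & c = chow_pi p.

End ChowRing.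

Definition has_dim (K : fieldType) (V : lmodType K) (U : V -> Prop) (d : nat) :=
  exists b : 'I_d -> V,
    (forall v, U v <-> exists c : 'I_d -> K, v = \sum_i c i *: b i) /\
    (forall c : 'I_d -> K, \sum_i c i *: b i = 0 -> forall i, c i = 0).

(* [H] is the (a priori infinite) Hilbert series of the Chow ring. *)
Definition is_chow_polynomial (M : matroid) (H : {poly int}) : Prop :=
  forall k, exists2 d, has_dim (@chow_piece M k) d & H`_k = d%:Z.

Lemma has_dim_leq (K : fieldType) (V : lmodType K) (U : V -> Prop) d e :
  has_dim U d -> has_dim U e -> (d <= e)%N.
Proof.
move=> [b [bU bfree]] [b' [b'U _]].
have [A AE] : exists A : 'M[K]_(d, e), forall i, b i = \sum_j A i j *: b' j.
  have /choice[f fE] : forall i, exists c : 'I_e -> K, b i = \sum_j c j *: b' j.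
    move=> i; apply/b'U/bU; exists (fun j => (j == i)%:R).
    rewrite (bigD1 i) //= eqxx scale1r big1 ?addr0 // => j /negPf ->.
    by rewrite scale0r.
  exists (\matrix_(i, j) f i j) => i; rewrite fE.
  by apply: eq_bigr => j _; rewrite mxE.
suff: row_free A by rewrite /row_free => /eqP <-; exact: rank_leq_col.
apply/inj_row_free => v vA0; apply/rowP=> i; rewrite mxE.
apply: (bfree (v 0)); under eq_bigr => j _ do rewrite AE scaler_sumr.
rewrite exchange_big big1 //= => j _.
under eq_bigr => k _ do rewrite scalerA.
by move/rowP/(_ j): vA0; rewrite !mxE -scaler_suml => ->; rewrite scale0r.
Qed.

Lemma is_chow_polynomial_uniq M H1 H2 :
  is_chow_polynomial M H1 -> is_chow_polynomial M H2 -> H1 = H2.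
Proof.
move=> h1 h2; apply/polyP=> k; have [d dP ->] := h1 k; have [e eP ->] := h2 k.
by congr Posz; apply/eqP; rewrite eqn_leq !(has_dim_leq dP eP, has_dim_leq eP dP).
Qed.

Section Arrangement.

Variables (K : fieldType) (n : nat).

Definition hyperplane (v : 'rV[K]_n) : {vspace 'rV[K]_n} :=
  lker (linfun (mulmxr v^T : 'rV[K]_n -> 'M[K]_1)).

Lemma hyperplaneP (v x : 'rV[K]_n) :
  reflect (\sum_i x 0 i * v 0 i = 0) (x \in hyperplane v).
Proof.
have E : (x *m v^T) 0 0 = \sum_i x 0 i * v 0 i.
  by rewrite mxE; apply: eq_bigr => i _; rewrite mxE.
rewrite memv_ker lfunE /= -E; apply: (iffP eqP) => [->|h]; first by rewrite mxE.
by rewrite [LHS]mx11_scalar h raddf0.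
Qed.

Lemma dim_hyperplane v : (n <= (\dim (hyperplane v)).+1)%N.
Proof.
set f := linfun (mulmxr v^T : 'rV[K]_n -> 'M[K]_1).
have := limg_ker_dim f fullv; rewrite capfv dimvf /dim /= mul1n.
have := dimvS (subvf (limg f)); rewrite dimvf /dim /=.
rewrite -[lker f]/(hyperplane v); move: (\dim _) (\dim _) => a b; lia.
Qed.

Variable normals : seq 'rV[K]_n.

Definition hyperplanes : finType := seq_sub [seq hyperplane v | v <- normals].

Definition arr_cap (S : {set hyperplanes}) : {vspace 'rV[K]_n} :=
  (\bigcap_(H in S) val H)%VS.

Definition arr_rk (S : {set hyperplanes}) : nat := n - \dim (arr_cap S).

Lemma arr_cap_dim S : (\dim (arr_cap S) <= n)%N.
Proof.
by rewrite (leq_trans (dimvS (subvf _))) // dimvf /dim /= mul1n.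
Qed.

Lemma arr_cap_mono (S T : {set hyperplanes}) :
  S \subset T -> (arr_cap T <= arr_cap S)%VS.
Proof.
by move=> /subsetP sST; apply/subv_bigcapP=> H HS; apply: (@bigcapv_inf _ _ _ H); rewrite ?sST.
Qed.

Lemma arr_rk_mono (S T : {set hyperplanes}) : S \subset T -> (arr_rk S <= arr_rk T)%N.
Proof. by move=> sST; rewrite leq_sub2l // dimvS // arr_cap_mono. Qed.

Lemma arr_rk_submod S T :
  (arr_rk (S :|: T) + arr_rk (S :&: T) <= arr_rk S + arr_rk T)%N.
Proof.
have capU : (arr_cap S :&: arr_cap T <= arr_cap (S :|: T))%VS.
  apply/subv_bigcapP=> H /setUP[HS|HT].
    by rewrite (subv_trans (capvSl _ _)) // (@bigcapv_inf _ _ _ H).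
  by rewrite (subv_trans (capvSr _ _)) // (@bigcapv_inf _ _ _ H).
have addI : (arr_cap S + arr_cap T <= arr_cap (S :&: T))%VS.
  by rewrite subv_add !arr_cap_mono ?subsetIl ?subsetIr.
have := dimv_sum_cap (arr_cap S) (arr_cap T).
move: (dimvS capU) (dimvS addI); rewrite /arr_rk.
move: (arr_cap_dim S) (arr_cap_dim T).
move: (arr_cap_dim (S :|: T)) (arr_cap_dim (S :&: T)).
move: (\dim (arr_cap S)) (\dim (arr_cap T)) => a b.
move: (\dim (arr_cap (S :|: T))) (\dim (arr_cap (S :&: T))) => c d.
move: (\dim (_ :&: _)) (\dim (_ + _)) => e f; lia.
Qed.

Lemma arr_rk_le_card S : (arr_rk S <= #|S|)%N.
Proof.
have [m] := ubnP #|S|; elim: m S => // m IH S.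
have [->|[H HS]] := set_0Vmem S.
  by rewrite /arr_rk /arr_cap big_set0 dimvf /dim /= mul1n subnn.
rewrite (cardsD1 H S) HS add1n ltnS => /IH; rewrite /arr_rk.
have -> : arr_cap S = (val H :&: arr_cap (S :\ H))%VS.
  rewrite /arr_cap (bigD1 H) //=; congr (_ :&: _)%VS.
  by apply: eq_bigl => G; rewrite !inE andbC.
have /mapP[v _ ->] := valP H.
have := dimv_sum_cap (hyperplane v) (arr_cap (S :\ H)).
have := dimvS (subvf (hyperplane v + arr_cap (S :\ H))).
rewrite dimvf /dim /= mul1n; have := dim_hyperplane v; lia.
Qed.

Definition arr_matroid : matroid :=
  Matroid arr_rk_le_card arr_rk_mono arr_rk_submod.

End Arrangement.

Definition typeB_normals (K : fieldType) (n : nat) : seq 'rV[K]_n :=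
  let e (i : 'I_n) : 'rV[K]_n := delta_mx 0 i in
  [seq e ij.1 + e ij.2 | ij : 'I_n * 'I_n <- enum {: 'I_n * 'I_n} & (ij.1 < ij.2)%N] ++
  [seq e ij.1 - e ij.2 | ij : 'I_n * 'I_n <- enum {: 'I_n * 'I_n} & (ij.1 < ij.2)%N] ++
  [seq e i | i : 'I_n].

Definition typeB_matroid (R : realType) (n : nat) : matroid :=
  arr_matroid (typeB_normals R n).

(* The entries of a sequence are numbered from 1. *)
Definition entry (a : seq nat) (i : nat) : nat := nth 0%N a i.-1.

Definition des (a : seq nat) : nat :=
  count (fun i => entry a i.+1 < entry a i)%N (iota 1 (size a).-1).

Definition admissible (n : nat) (a : seq nat) : bool :=
  [&& all (fun i => 1 <= entry a i <= n.+1 - i)%N (iota 1 n),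
      (1 < n)%N ==> (entry a 1 <= entry a 2)%N
    & all (fun i => (entry a i.+1 < entry a i)%N ==>
                    (entry a i.-1 <= entry a i)%N) (iota 2 (n - 2))].

(* Main.v *)
(** The Chow ring of a loopless matroid has the Feichtner-Yuzvinsky basis: the
    monomials x_F1^a1 ... x_Fk^ak along chains 0 = F_0 < F_1 < ... < F_k with
    1 <= a_i < rk F_i - rk F_(i-1).  Spanning is a reduction by the relations
    x_F (sum_(H >= G) x_H)^(rk G - rk F) = 0.  For independence the flats are
    blown up one at a time: with F0 minimal in the new set of flats, d its
    relative rank and h the sum of the x_H with H > F0, the substitution
    x_F0 = y - h turns the only new relation of pure type into y^d = 0, so the
    coefficients of the powers of x_F0 lie in the ideal of the contraction by
    F0, and the rest in the ideal of the previous blow-up.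

    Splitting off the least flat of the chain, the Hilbert series P_B of the
    interval above B satisfies
    P_B = 1 + sum_(F > B) (x + ... + x^(rk F - rk B - 1)) P_F.
    For type B the number of flats of relative rank l above B depends only on
    m = n - rk B: the points of {-q..q}^n lying on B are counted by their
    smallest flat, so (2q+1)^m = sum_l W(m, l) 2^(m-l) q(q-1)...(q-m+l+1) for
    all q, and Newton interpolation gives for W(m, l) the total weight of the
    weakly increasing words of length l with i-th letter at most m+1-i, where
    a letter a weighs 2a-1.  The gamma-expansion then follows word by word,
    cutting a word at the end of an initial weakly increasing piece. *)

From HB Require Import structures.
Require Import Defs.
From mathcomp Require Import all_boot all_order all_algebra reals.
From mathcomp Require Import boolp mpoly zify ring.

Set Implicit Arguments.
Unset Strict Implicit.
Unset Printing Implicit Defensive.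

Import Order.TTheory GRing.Theory Num.Theory.
Local Open Scope ring_scope.

(** * Ideals as predicates on a commutative ring *)

Section IdealPredicates.

Variable A : comNzRingType.
Implicit Types (Q : A -> Prop) (G : A -> Prop).

Record is_ideal Q : Prop := IsIdeal {
  is_ideal0 : Q 0;
  is_idealD : forall p q, Q p -> Q q -> Q (p + q);
  is_idealM : forall a p, Q p -> Q (a * p)
}.

(** The generators form a predicate rather than a list, and the inductive form lets a property of
    the whole ideal be checked on one generator at a time. *)
Inductive generated G : A -> Prop :=
| generated0 : generated G 0
| generatedD a g p : G g -> generated G p -> generated G (a * g + p).

Lemma generated_ideal G : is_ideal (generated G).
Proof.
split; first exact: generated0.
- by move=> p q; elim=> [|a g p' Gg _ IH] Gq; rewrite ?add0r // -addrA;
    apply: generatedD => //; apply: IH.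
- move=> a p; elim=> [|b g p' Gg _ IH]; first by rewrite mulr0; apply: generated0.
  by rewrite mulrDr mulrA; apply: generatedD.
Qed.

Lemma generated_gen G g : G g -> generated G g.
Proof.
move=> Gg; rewrite -[g]mul1r -[_ * _]addr0.
by apply: generatedD => //; apply: generated0.
Qed.

Section Closure.

Variables (Q : A -> Prop) (idQ : is_ideal Q).

Lemma idealN p : Q p -> Q (- p).
Proof. by move=> Qp; rewrite -mulN1r; apply: is_idealM. Qed.

Lemma idealB p q : Q p -> Q q -> Q (p - q).
Proof. by move=> Qp Qq; apply: is_idealD => //; apply: idealN. Qed.

Lemma ideal_mulr a p : Q p -> Q (p * a).
Proof. by rewrite mulrC; apply: is_idealM. Qed.

Lemma ideal_sum (I : Type) (r : seq I) (P : pred I) (F : I -> A) :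
  (forall i, P i -> Q (F i)) -> Q (\sum_(i <- r | P i) F i).
Proof.
by move=> QF; elim/big_rec: _ => [|i x Pi Qx]; [apply: is_ideal0 | apply: is_idealD; auto].
Qed.

Lemma ideal_congr p q : Q (p - q) -> Q q -> Q p.
Proof. by move=> Qpq Qq; rewrite -(subrK q p); apply: is_idealD. Qed.

(** Since [u - v] divides [u ^+ k - v ^+ k], a factor [a] that identifies [u] with [v] modulo [Q]
    identifies their powers as well. *)
Lemma ideal_congrX a u v k : Q (a * (u - v)) -> Q (a * v ^+ k) -> Q (a * u ^+ k).
Proof.
move=> Quv; apply: ideal_congr; rewrite -mulrBr subrXX mulrA; exact: ideal_mulr.
Qed.

Lemma ideal_expW a u k l : (k <= l)%N -> Q (a * u ^+ k) -> Q (a * u ^+ l).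
Proof. by move=> /subnK <- Qu; rewrite addnC exprD mulrA; apply: ideal_mulr. Qed.

End Closure.

End IdealPredicates.

(** This is the ideal generated by [Q] and ['X^d]: the i-th coefficient of a product only involves
    coefficients of index at most i. *)
Lemma coef_ideal (A : comNzRingType) (Q : A -> Prop) d : is_ideal Q ->
  is_ideal (fun q : {poly A} => forall i, (i < d)%N -> Q q`_i).
Proof.
move=> idQ; split=> [i _|p q Qp Qq i ltid|a p Qp i ltid].
- by rewrite coef0; apply: is_ideal0.
- by rewrite coefD; apply: is_idealD; auto.
- rewrite coefM; apply: ideal_sum => // j _; apply: is_idealM => //; apply: Qp.
  by rewrite (leq_ltn_trans (leq_subr _ _)).
Qed.


(** * Closure and flats of a matroid *)

Section Flats.

Variable M : matroid.
Implicit Types (A B F G : {set M}).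

Definition mclosure A : {set M} := [set i | rk (i |: A) == rk A].

Lemma sub_mclosure A : A \subset mclosure A.
Proof. by apply/subsetP=> i iA; rewrite inE (setUidPr _) ?sub1set. Qed.

(** The elements of [B] are added one by one: [A :|: B :\ i] and [i |: A] both have the rank of [A]
    and meet in a set containing [A], so submodularity bounds the rank of their union. *)
Lemma rk_setU_mclosure A B : B \subset mclosure A -> rk (A :|: B) = rk A.
Proof.
have [m] := ubnP #|B|; elim: m B => // m IH B.
have [->|[i iB]] := set_0Vmem B; first by rewrite setU0.
rewrite (cardsD1 i B) iB add1n ltnS => /IH{}IH sB.
have {}IH : rk (A :|: B :\ i) = rk A by rewrite IH // (subset_trans _ sB) ?subsetDl.
have ri : rk (i |: A) = rk A by apply/eqP; move/subsetP/(_ i iB): sB; rewrite inE.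
have sm := rk_submod (A :|: B :\ i) (i |: A).
have /rk_mono m1 : A \subset (A :|: B :\ i) :&: (i |: A).
  by rewrite subsetI subsetUl subsetUr.
have /rk_mono m2 : A \subset A :|: B by rewrite subsetUl.
have E : A :|: B :\ i :|: (i |: A) = A :|: B.
  apply/setP=> j; rewrite !inE; case: (j =P i) => [->|_]; first by rewrite iB !orbT.
  by case: (j \in A); rewrite ?orbT //= orbF.
rewrite E in sm; apply/eqP; rewrite eqn_leq m2 andbT; lia.
Qed.

Lemma rk_mclosure A : rk (mclosure A) = rk A.
Proof.
by rewrite -(rk_setU_mclosure (subxx (mclosure A))) (setUidPr (sub_mclosure A)).
Qed.

Lemma flatP F : reflect (forall i, i \notin F -> (rk F < rk (i |: F))%N) (flat F).
Proof. by apply: (iffP forallP) => h i; apply/implyP/h. Qed.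

Lemma mclosure_flat A : flat (mclosure A).
Proof.
apply/flatP => i; rewrite inE rk_mclosure ltn_neqAle eq_sym => ni.
have /rk_mono h : i |: A \subset i |: mclosure A by rewrite setUS // sub_mclosure.
have /rk_mono h' : A \subset i |: A by apply: subsetUr.
by move/eqP: ni => ni; apply/andP; split; [apply/eqP; lia | lia].
Qed.

Lemma flat_rk_ltU F A : flat F -> ~~ (A \subset F) -> (rk F < rk (F :|: A))%N.
Proof.
move=> /flatP fF /subsetPn[i iA niF]; apply: leq_trans (fF i niF) _.
by apply: rk_mono; rewrite setUC setUS // sub1set.
Qed.

(** Otherwise [F :|: mclosure A] has larger rank than [F], while [F :&: mclosure A] contains [A] and
    so has at least the rank of [mclosure A], against submodularity. *)
Lemma mclosure_min A F : flat F -> A \subset F -> mclosure A \subset F.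
Proof.
move=> fF sAF; apply/negPn/negP => /(flat_rk_ltU fF).
have := rk_submod F (mclosure A); rewrite rk_mclosure.
have /rk_mono : A \subset F :&: mclosure A by rewrite subsetI sAF sub_mclosure.
lia.
Qed.

Lemma flat_rk_proper F G : flat F -> F \proper G -> (rk F < rk G)%N.
Proof.
move=> fF /properP[/setUidPr E [i iG niF]]; rewrite -E.
by apply: flat_rk_ltU => //; apply/subsetPn; exists i.
Qed.

Lemma rkU_sub B A F : B \subset A -> B \subset F ->
  (rk (A :|: F) - rk F <= rk A - rk B)%N.
Proof.
move=> sBA sBF; have := rk_submod A F.
have /rk_mono : B \subset A :&: F by rewrite subsetI sBA.
lia.
Qed.

End Flats.

(** * The ideals of the successive blow-ups *)

Section FYIdeal.

Variable M : matroid.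

Local Notation fl := (nonempty_flat M).
Local Notation N := #|{: nonempty_flat M}|.
Local Notation S := {mpoly rat[N]}.

Implicit Types (A B : {set M}) (F G H : fl) (P : {set fl}).

Definition flat_var F : S := 'X_(enum_rank F).
Local Notation x := flat_var.

Definition hsum P A : S := \sum_(H in P | A \subset val H) x H.

Definition above B : {set fl} := [set F : fl | B \proper val F].

Definition up_closed P := forall F G, F \in P -> val F \subset val G -> G \in P.

(* Relations of the blow-up along the flats of [P] in the interval above [B]: the
   variables of the flats not yet blown up are set to zero. *)
Inductive fy_gen B P : S -> Prop :=
| FyOut F of F \notin P : fy_gen B P (x F)
| FyInc F G of F \in P & G \in P & incomparable (val F) (val G) :
    fy_gen B P (x F * x G)
| FyRel F G of F \in P & G \in P & val F \proper val G :
    fy_gen B P (x F * hsum P (val G) ^+ (rk (val G) - rk (val F)))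
| FyBase G of G \in P :
    fy_gen B P (hsum P (val G) ^+ (rk (val G) - rk B)).

Definition fy_ideal B P := generated (fy_gen B P).

Lemma fy_is_ideal B P : is_ideal (fy_ideal B P).
Proof. exact: generated_ideal. Qed.
Hint Resolve fy_is_ideal : core.

Lemma val_flat F : flat (val F).
Proof. by case/andP: (valP F). Qed.

Lemma val_nonempty F : val F != set0.
Proof. by case/andP: (valP F). Qed.

Lemma mclosure_nonempty_flat A : A != set0 -> exists J : fl, val J = mclosure A.
Proof.
move=> /set0Pn[i iA]; have h : flat (mclosure A) && (mclosure A != set0).
  by rewrite mclosure_flat; apply/set0Pn; exists i; rewrite (subsetP (sub_mclosure A)).
by exists (Sub (mclosure A) h); rewrite SubK.
Qed.

Lemma hsum_mclosure P A : hsum P (mclosure A) = hsum P A.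
Proof.
apply: eq_bigl => H; congr (_ && _); apply/idP/idP.
  exact/subset_trans/sub_mclosure.
exact/mclosure_min/val_flat.
Qed.

(** A flat containing [A] but not [F] is incomparable to [F], because [A] is not inside [F]. Hence
    multiplication by [x F] kills all terms of [hsum P A] except those above [F]. *)
Lemma mul_hsum Q P F A : is_ideal Q ->
  (forall F G, F \in P -> G \in P -> incomparable (val F) (val G) -> Q (x F * x G)) ->
  F \in P -> ~~ (A \subset val F) ->
  Q (x F * (hsum P A - hsum P (val F :|: A))).
Proof.
move=> idQ Qinc FP nAF; rewrite {1}/hsum (bigID (fun H => val F \subset val H)) /=.
rewrite [X in X + _ - _](_ : _ = hsum P (val F :|: A)); last first.
  by apply: eq_bigl => H; rewrite subUset -andbA; congr (_ && _); rewrite andbC.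
rewrite addrAC subrr add0r mulr_sumr; apply: ideal_sum => // H /andP[/andP[HP AH] nFH].
apply: Qinc => //; rewrite /incomparable nFH /=.
by apply: contra nAF; apply: subset_trans.
Qed.

Section FilterRelations.

Variables (B : {set M}) (P : {set fl}).
Hypothesis upP : up_closed P.

(** Extends [FyRel] from flats above [F] to arbitrary sets: [A] is replaced by the closure of its
    union with [F], which lies in [P] by up-closure. *)
Lemma fy_rel F A k : F \in P -> ~~ (A \subset val F) ->
  (rk (val F :|: A) - rk (val F) <= k)%N ->
  fy_ideal B P (x F * hsum P A ^+ k).
Proof.
move=> FP nAF lek; apply: (ideal_congrX (fy_is_ideal B P) (v := hsum P (val F :|: A))).
  by apply: mul_hsum => // F' G' FP' GP' inc; apply/generated_gen/FyInc.
have [|J JE] := @mclosure_nonempty_flat (val F :|: A).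
  by have /set0Pn[i iF] := val_nonempty F; apply/set0Pn; exists i; rewrite inE iF.
have sFJ : val F :|: A \subset val J by rewrite JE sub_mclosure.
rewrite -hsum_mclosure -JE; apply: ideal_expW lek _ => //.
rewrite -rk_mclosure -JE; apply/generated_gen/FyRel => //.
  by apply: upP FP _; apply: subset_trans sFJ; apply: subsetUl.
rewrite properE (subset_trans _ sFJ) ?subsetUl //=.
by apply: contra nAF => h; apply: subset_trans h; apply: subset_trans sFJ; apply: subsetUr.
Qed.

(** Next to the power of [hsum P (val G)], each [x H] with [H] above [F0] but not above [G] vanishes
    by [fy_rel], so [hsum P (val F0)] may be replaced by [hsum P (val G)]. The exponents then add up
    to that of [FyBase]. This is what remains of the relation between a new flat [F0] and [G] once
    [x F0] is removed. *)
Lemma fy_base_rel F0 G : B \subset val F0 -> val F0 \proper val G -> G \in P ->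
  fy_ideal B P (hsum P (val F0) ^+ (rk (val F0) - rk B)
                * hsum P (val G) ^+ (rk (val G) - rk (val F0))).
Proof.
move=> sB pFG GP; set k := (rk (val G) - _)%N; rewrite mulrC.
apply: (ideal_congrX (fy_is_ideal B P) (v := hsum P (val G))).
  rewrite {2}/hsum (bigID (fun H => val G \subset val H)) /=.
  rewrite [X in X + _ - _](_ : _ = hsum P (val G)); last first.
    apply: eq_bigl => H; rewrite -andbA; congr (_ && _).
    apply/andP/idP => [[] //|h]; split=> //; apply: subset_trans h.
    exact: proper_sub.
  rewrite addrAC subrr add0r mulr_sumr; apply: ideal_sum => // H /andP[/andP[HP sFH] nGH].
  rewrite mulrC; apply: fy_rel => //; rewrite setUC; apply: rkU_sub => //.
  exact: proper_sub.
rewrite -exprD.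
have -> : (k + (rk (val F0) - rk B) = rk (val G) - rk B)%N.
  have := rk_mono sB; have := rk_mono (proper_sub pFG); rewrite /k; lia.
by apply/generated_gen/FyBase.
Qed.

End FilterRelations.

Lemma above_up B : up_closed (above B).
Proof. by move=> F G; rewrite !inE => /proper_sub_trans h /h. Qed.

Section Sigma.

Variables (F0 : fl) (h : S).

Definition sigma_var (i : 'I_N) : {poly S} :=
  if i == enum_rank F0 then 'X - h%:P else ('X_i : S)%:P.

(* Maps [x F0 + h] to ['X], so that its power relation becomes ['X^d = 0]. *)
Definition sigma : S -> {poly S} := mmap (polyC \o @mpolyC N rat) sigma_var.

HB.instance Definition _ := GRing.RMorphism.copy sigma (mmap (polyC \o @mpolyC N rat) sigma_var).

Lemma sigma_var_eq : sigma (x F0) = 'X - h%:P.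
Proof. by rewrite /sigma mmapX mmap1U /sigma_var eqxx. Qed.

Lemma sigma_var_neq F : F != F0 -> sigma (x F) = (x F)%:P.
Proof.
move=> nF; rewrite /sigma mmapX mmap1U /sigma_var; case: eqP => // /enum_rank_inj E.
by rewrite E eqxx in nF.
Qed.

Lemma sigmaC (c : rat) : sigma c%:MP = (c%:MP)%:P.
Proof. by rewrite /sigma mmapC. Qed.

Lemma sigma_free (p : S) :
  (forall m, m \in msupp p -> m (enum_rank F0) = 0%N) -> sigma p = p%:P.
Proof.
move=> hp; rewrite [in RHS](mpolyE p) rmorph_sum /= /sigma /mmap.
apply: eq_big_seq => m /hp m0 /=; rewrite -mul_mpolyC rmorphM /=; congr (_ * _).
rewrite mpolyXE_id rmorph_prod /=; apply: eq_bigr => i _; rewrite rmorphXn /=.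
by rewrite /sigma_var; case: eqP => // ->; rewrite m0 !expr0.
Qed.

Lemma sigma_hsum P A : F0 \notin P -> sigma (hsum P A) = (hsum P A)%:P.
Proof.
move=> nF; rewrite /hsum !rmorph_sum /=; apply: eq_bigr => H /andP[HP _].
by rewrite sigma_var_neq //; apply: contraNneq nF => <-.
Qed.

End Sigma.

Section Peel.

Variables (B : {set M}) (P : {set fl}) (F0 : fl).
Hypotheses (upP : up_closed P) (F0P : F0 \notin P).
Hypotheses (PB : {subset P <= above B}) (F0B : F0 \in above B).
Hypothesis (aboveF0 : {subset above (val F0) <= P}).

Let d := (rk (val F0) - rk B)%N.
Let h := hsum P (val F0).
Let P' := F0 |: P.
Local Notation sg := (sigma F0 h).

Let sBF0 : B \subset val F0. Proof. by have := F0B; rewrite inE; apply: proper_sub. Qed.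

Let notsub G : G \in P -> ~~ (val G \subset val F0).
Proof. by move=> GP; apply: contra F0P; apply: upP. Qed.

Let hsum_big G : G \in P -> hsum P' (val G) = hsum P (val G).
Proof.
move=> GP; apply: eq_bigl => H; rewrite in_setU1; case: eqP => //= ->.
by rewrite (negPf F0P) (negPf (notsub GP)).
Qed.

Let hsum_F0 : hsum P' (val F0) = x F0 + h.
Proof.
rewrite /hsum (bigD1 F0) /=; last by rewrite setU11 subxx.
congr (_ + _); apply: eq_bigl => H; rewrite in_setU1 andbC.
by case: eqP => [->|] //=; rewrite (negPf F0P).
Qed.

Let hsum_above G : val F0 \subset val G ->
  hsum P (val G) = hsum (above (val F0)) (val G).
Proof.
move=> sFG; apply: eq_bigl => H; apply/andP/andP => -[HP GH]; split=> //; last exact: aboveF0.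
rewrite inE properE (subset_trans sFG) //=; exact: notsub.
Qed.

(** Modulo the ideal of the contraction, the variables of flats not above [F0] are zero. Each
    generator of the blow-up then becomes a relation of the interval above [F0], except the base
    relation of [F0] itself, which becomes ['X^d] and has no coefficient below [d]. *)
Lemma fy_step_coef p : fy_ideal B P' p ->
  forall i, (i < d)%N -> fy_ideal (val F0) (above (val F0)) (sg p)`_i.
Proof.
set P0 := above _; have up0 : up_closed P0 by exact: above_up.
have idK := coef_ideal d (fy_is_ideal (val F0) P0).
have idC u : fy_ideal (val F0) P0 u -> forall i, (i < d)%N -> fy_ideal (val F0) P0 u%:P`_i.
  by move=> Iu i _; rewrite coefC; case: ifP => // _; apply: is_ideal0.
have xout F : F \notin P0 -> fy_ideal (val F0) P0 (x F) by move=> h1; apply/generated_gen/FyOut.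
elim=> [i _|a g q Gg _ IH].
  by rewrite rmorph0 coef0; apply: is_ideal0.
rewrite rmorphD rmorphM /=; apply: (is_idealD idK) => //; apply: (is_idealM idK).
case: Gg => [F FP'|F G FP' GP' inc|F G FP' GP' pFG|G GP'] {a q IH}.
- rewrite in_setU1 negb_or in FP'; case/andP: FP' => nF nFP.
  rewrite sigma_var_neq //; apply/idC/xout; by apply: contra nFP; apply: aboveF0.
- rewrite rmorphM /=; have [EF|nF] := eqVneq F F0.
    have nG : G != F0 by apply: contraTneq inc => ->; rewrite EF /incomparable subxx.
    apply: (is_idealM idK); rewrite sigma_var_neq //; apply/idC/xout.
    by rewrite inE properE -EF; case/andP: inc => /negPf ->.
  have [EG|nG] := eqVneq G F0.
    rewrite mulrC; apply: (is_idealM idK); rewrite sigma_var_neq //; apply/idC/xout.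
    by rewrite inE properE -EG; case/andP: inc => _ /negPf ->.
  rewrite !sigma_var_neq // -polyCM; apply: idC.
  have [F0F|] := boolP (F \in P0); last by move/xout=> Ix; apply: (ideal_mulr (fy_is_ideal _ _)).
  have [F0G|] := boolP (G \in P0); last by move/xout=> Ix; apply: (is_idealM (fy_is_ideal _ _)).
  by apply/generated_gen/FyInc.
- have GP : G \in P.
    move: GP'; rewrite in_setU1 => /orP[/eqP GF|//]; move: FP'; rewrite in_setU1.
    move=> /orP[/eqP FF|FP]; first by rewrite FF GF properxx in pFG.
    exact: upP FP (proper_sub pFG).
  rewrite hsum_big // rmorphM /= rmorphXn /= sigma_hsum // -polyC_exp.
  have [EF|nF] := eqVneq F F0.
    (* With [F0] as the new bottom, the power relation between [F0] and [G] is a base relation. *)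
    apply: (is_idealM idK); apply: idC; rewrite hsum_above ?EF //; last first.
      by rewrite -EF proper_sub.
    by apply/generated_gen/FyBase; rewrite inE -EF.
  rewrite !sigma_var_neq // -polyCM; apply: idC.
  have [F0F|] := boolP (F \in P0); last by move/xout=> Ix; apply: (ideal_mulr (fy_is_ideal _ _)).
  have sFG := proper_sub pFG.
  have sF0 : val F0 \subset val F by rewrite inE in F0F; exact: proper_sub.
  rewrite hsum_above ?(subset_trans sF0) //; apply/generated_gen/FyRel => //.
  exact: up0 F0F sFG.
- have [->|nG] := eqVneq G F0.
    rewrite hsum_F0 rmorphXn rmorphD /= sigma_var_eq sigma_hsum // subrK.
    by move=> i ltid; rewrite coefXn ltn_eqF //; apply: is_ideal0.
  have GP : G \in P by move: GP'; rewrite in_setU1 (negPf nG).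
  rewrite hsum_big // rmorphXn /= sigma_hsum // -polyC_exp; apply: idC.
  rewrite -[_ ^+ _]mul1r.
  (* [G] need not lie above [F0], so it is replaced by the closure [J] of the union. The base
     relation of [J] suffices, as [rk J - rk F0] is at most [rk G - rk B]. *)
  apply: (ideal_congrX (fy_is_ideal _ _) (v := hsum P0 (val F0 :|: val G))).
    rewrite mul1r {1}/hsum (bigID (fun H => val F0 \subset val H)) /=.
    rewrite [X in X + _ - _](_ : _ = hsum P0 (val F0 :|: val G)); last first.
      apply: eq_bigl => H; rewrite subUset; apply/idP/idP.
        move=> /andP[/andP[HP ->] F0H]; rewrite F0H !andbT inE properE F0H /=.
        exact: notsub.
      by move=> /and3P[HP -> ->]; rewrite (aboveF0 HP).
    rewrite addrAC subrr add0r; apply: ideal_sum => // H /andP[_ nF0H].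
    by apply: xout; rewrite inE properE (negPf nF0H).
  rewrite mul1r; have [|J JE] := @mclosure_nonempty_flat (val F0 :|: val G).
    by have /set0Pn[i iF] := val_nonempty F0; apply/set0Pn; exists i; rewrite inE iF.
  have sJ : val F0 :|: val G \subset val J by rewrite JE sub_mclosure.
  rewrite -hsum_mclosure -JE -[_ ^+ _]mul1r.
  apply: (@ideal_expW _ _ (fy_is_ideal _ _) _ _ (rk (val J) - rk (val F0))).
    rewrite JE rk_mclosure setUC; apply: rkU_sub => //.
    by have := PB GP; rewrite inE; apply: proper_sub.
  rewrite mul1r; apply/generated_gen/FyBase; rewrite inE properE.
  rewrite (subset_trans _ sJ) ?subsetUl //=; apply: contra (notsub GP) => sJF.
  by apply: subset_trans sJF; apply: subset_trans sJ; apply: subsetUr.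
Qed.

(* If A is the ring before and A' the ring of the center, the blow-up along [F0] is
   A (+) x A' (+) ... (+) x^(d-1) A'; truncating and evaluating at [h], i.e. at
   [x F0 = 0], is the projection onto A. *)
Lemma fy_step_take p : fy_ideal B P' p -> fy_ideal B P (take_poly d (sg p)).[h].
Proof.
have idI := fy_is_ideal B P.
have T1 q u : fy_ideal B P u -> fy_ideal B P (take_poly d (q * u%:P)).[h].
  move=> Iu; rewrite mulrC mul_polyC take_polyZ hornerZ; exact: ideal_mulr.
(* The product of [q] with ['X - h%:P] vanishes at [h], so its truncation takes there the value of
   the discarded part with opposite sign, a multiple of [h ^+ d]. *)
have T3 q u : fy_ideal B P (h ^+ d * u) ->
    fy_ideal B P (take_poly d (q * (('X - h%:P) * u%:P))).[h].
  move=> Iu; rewrite mulrA [_ * u%:P]mulrC mul_polyC take_polyZ hornerZ.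
  set q' := q * _; have E := poly_take_drop d q'.
  have -> : (take_poly d q').[h] = - ((drop_poly d q').[h] * h ^+ d).
    apply/eqP; rewrite -addr_eq0 -hornerXn -hornerM -hornerD E /q' hornerM.
    by rewrite hornerXsubC subrr mulr0.
  rewrite mulrN mulrCA [u * _]mulrC; apply: idealN => //; exact: is_idealM.
have hx G : incomparable (val F0) (val G) -> G \in P -> fy_ideal B P (h ^+ d * x G).
  move=> /andP[nFG nGF] GP; rewrite mulrC; apply: fy_rel => //.
  rewrite setUC; apply: rkU_sub => //.
  by have := PB GP; rewrite inE; apply: proper_sub.
elim=> [|a g q Gg _ IH]; first by rewrite rmorph0 take_poly0r horner0; apply: is_ideal0.
rewrite [sg (_ + _)]rmorphD /= take_polyD hornerD.
apply: (is_idealD idI); last exact: IH.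
rewrite [sg (_ * _)]rmorphM /=; move: (sg a) => {}a {q IH}.
case: Gg => [F FP'|F G FP' GP' inc|F G FP' GP' pFG|G GP'].
- rewrite in_setU1 negb_or in FP'; case/andP: FP' => nF nFP.
  by rewrite sigma_var_neq //; apply/T1/generated_gen/FyOut.
- rewrite rmorphM /=; have [EF|nF] := eqVneq F F0.
    have nG : G != F0 by apply: contraTneq inc => ->; rewrite EF /incomparable subxx.
    have GP : G \in P by move: GP'; rewrite in_setU1 (negPf nG).
    rewrite EF sigma_var_eq sigma_var_neq //; apply/T3/hx => //; by rewrite -EF.
  have FP : F \in P by move: FP'; rewrite in_setU1 (negPf nF).
  have [EG|nG] := eqVneq G F0.
    rewrite EG [X in a * X]mulrC sigma_var_eq sigma_var_neq //.
    by apply/T3/hx; rewrite // /incomparable andbC -EG.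
  have GP : G \in P by move: GP'; rewrite in_setU1 (negPf nG).
  by rewrite !sigma_var_neq // -polyCM; apply/T1/generated_gen/FyInc.
- have GP : G \in P.
    move: GP'; rewrite in_setU1 => /orP[/eqP GF|//]; move: FP'; rewrite in_setU1.
    move=> /orP[/eqP FF|FP]; first by rewrite FF GF properxx in pFG.
    exact: upP FP (proper_sub pFG).
  rewrite hsum_big // rmorphM /= rmorphXn /= sigma_hsum // -polyC_exp.
  have [EF|nF] := eqVneq F F0.
    rewrite EF sigma_var_eq; apply: T3; apply: fy_base_rel => //; by rewrite -EF.
  have FP : F \in P by move: FP'; rewrite in_setU1 (negPf nF).
  by rewrite sigma_var_neq // -polyCM; apply/T1/generated_gen/FyRel.
- have [->|nG] := eqVneq G F0.
    rewrite hsum_F0 rmorphXn rmorphD /= sigma_var_eq sigma_hsum // subrK.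
    by rewrite take_polyMXn_0 horner0; apply: is_ideal0.
  have GP : G \in P by move: GP'; rewrite in_setU1 (negPf nG).
  rewrite hsum_big // rmorphXn /= sigma_hsum // -polyC_exp.
  by apply/T1/generated_gen/FyBase.
Qed.

End Peel.

End FYIdeal.

(** * Linear independence of the chain monomials *)

Section FYBasis.

Variable M : matroid.

Local Notation fl := (nonempty_flat M).
Local Notation N := #|{: nonempty_flat M}|.
Local Notation S := {mpoly rat[N]}.
Local Notation x := (@flat_var M).

Implicit Types (A B : {set M}) (F G H : fl) (P : {set fl}).

Definition vars_above A (m : 'X_{1..N}) :=
  forall G, m (enum_rank G) != 0%N -> A \proper val G.

Lemma fy_ideal0_const B (p : S) : fy_ideal B set0 p -> p@_0%MM = 0.
Proof.
elim=> [|a g q Gg _ IH]; first by rewrite mcoeff0.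
rewrite mcoeffD IH addr0 rmorphM /=; case: Gg => [F _|F G|F G|G]; rewrite ?inE //.
rewrite /flat_var mcoeffX; case: eqP => [/(congr1 (@mdeg _))|_]; last by rewrite mulr0.
by rewrite mdeg1 mdeg0.
Qed.

Lemma comp_poly_coef_ideal (A : comNzRingType) (Q : A -> Prop) (q r : {poly A}) :
  is_ideal Q -> (forall i, Q q`_i) -> forall i, Q (q \Po r)`_i.
Proof.
move=> idQ Qq i; rewrite coef_comp_poly; apply: ideal_sum => // j _.
exact: ideal_mulr.
Qed.

(** The flats of [P] are removed one at a time, undoing the blow-ups. Each removal isolates the
    coefficients belonging to one flat and leaves a relation of the same shape over the remaining
    flats. *)
Lemma fy_peel B P (c : rat) (p : fl -> nat -> S) : flat B ->
  up_closed P -> {subset P <= above B} ->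
  (forall F j m, F \in P -> m \in msupp (p F j) -> vars_above (val F) m) ->
  fy_ideal B P (c%:MP + \sum_(F in P)
     \sum_(1 <= j < rk (val F) - rk B) x F ^+ j * p F j) ->
  c = 0 /\ forall F j, F \in P -> (0 < j < rk (val F) - rk B)%N ->
    fy_ideal (val F) (above (val F)) (p F j).
Proof.
move=> fB; have [k] := ubnP #|P|; elim: k P => // k IH P.
have [->|[F1 F1P]] := set_0Vmem P.
  move=> _ _ _ _; rewrite big_set0 addr0 => /fy_ideal0_const.
  by rewrite mcoeffC eqxx mulr1 => ->; split=> // F j; rewrite inE.
(* Minimal cardinality makes [F0] minimal in [P], so the other flats still form an up-closed set,
   and it contains everything above [F0]. *)
case: (arg_minnP (fun F : fl => #|val F|) F1P) => F0 F0P Fmin {F1 F1P}.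
have {}F0P : F0 \in P by [].
rewrite (cardsD1 F0) F0P add1n ltnS => /IH {}IH upP PB hp.
set P1 := P :\ F0 in IH; have P1P F : F \in P1 -> F \in P by case/setD1P.
have EP : P = F0 |: P1 by rewrite setD1K.
have F0P1 : F0 \notin P1 by rewrite setD11.
have minF0 F : F \in P -> ~~ (val F \proper val F0).
  by move=> FP; apply/negP => /proper_card; rewrite ltnNge Fmin.
have upP1 : up_closed P1.
  move=> F G /setD1P[nF FP] sFG; rewrite in_setD1 (upP _ _ FP sFG) andbT.
  apply: contraNneq (minF0 F FP) => GE; rewrite -GE properEneq sFG andbT.
  by rewrite (inj_eq val_inj) GE.
have P1B : {subset P1 <= above B} by move=> F /P1P /PB.
have F0B := PB _ F0P.
have aboveF0 : {subset above (val F0) <= P1}.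
  move=> F; rewrite inE => pF; rewrite in_setD1 (upP _ _ F0P (proper_sub pF)) andbT.
  by apply: contraTneq pF => ->; rewrite properxx.
set e0 := c%:MP + \sum_(F in P1) \sum_(1 <= j < rk (val F) - rk B) x F ^+ j * p F j.
set d := (rk (val F0) - rk B)%N; set h := hsum P1 (val F0).
have d_gt0 : (0 < d)%N.
  by rewrite subn_gt0; apply: flat_rk_proper => //; move: F0B; rewrite inE.
have sgp F j : F \in P -> sigma F0 h (p F j) = (p F j)%:P.
  move=> FP; apply: sigma_free => m /(hp _ _ _ FP) hm; apply/eqP.
  by apply: contraT => /hm; rewrite (negPf (minF0 F FP)).
have sge0 : sigma F0 h e0 = e0%:P.
  rewrite /e0 [LHS]rmorphD [RHS]rmorphD /= sigmaC; congr (_ + _).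
  rewrite [LHS]rmorph_sum [RHS]rmorph_sum; apply: eq_bigr => F /setD1P[nF FP].
  rewrite [LHS]rmorph_sum [RHS]rmorph_sum; apply: eq_bigr => j _.
  by rewrite [LHS]rmorphM [RHS]rmorphM /= sgp // rmorphXn /= sigma_var_neq // polyC_exp.
rewrite (big_setD1 F0) //= -/P1 addrCA -/d -/e0.
set e := _ + e0 => Ie; rewrite EP in Ie.
(* The degree is below [d], so truncation changes nothing, and as [j] starts at 1 only [e0] survives
   at [h]. *)
have seE : sigma F0 h e = e0%:P + \sum_(1 <= j < d) p F0 j *: ('X - h%:P) ^+ j.
  rewrite /e [LHS]rmorphD /= sge0 addrC; congr (_ + _).
  rewrite [LHS]rmorph_sum; apply: eq_bigr => j _.
  by rewrite [LHS]rmorphM /= sgp // rmorphXn /= sigma_var_eq mulrC mul_polyC.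
have size_q : (size (sigma F0 h e) <= d)%N.
  rewrite seE (leq_trans (size_polyD _ _)) // geq_max (leq_trans (size_polyC_leq1 _)) //=.
  rewrite big_nat; apply: (big_ind (fun q : {poly S} => (size q <= d)%N)).
  - by rewrite size_poly0.
  - by move=> q r hq hr; rewrite (leq_trans (size_polyD _ _)) // geq_max hq.
  - by move=> j /andP[_ jd]; rewrite (leq_trans (size_scale_leq _ _)) // size_exp_XsubC.
have [|//|c0 hpF] := IH upP1 P1B.
- by move=> F j m /P1P; apply: hp.
- rewrite -/e0; have := fy_step_take upP1 F0P1 P1B F0B Ie.
  rewrite -/d -/h take_poly_id // seE hornerD hornerC horner_sum big_nat big1 ?addr0 //.
  move=> j /andP[j0 _]; rewrite hornerZ horner_exp hornerXsubC subrr expr0n.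
  by rewrite -[j]prednK //= mulr0.
split=> // F j; have [->|nF] := eqVneq F F0; last first.
  by move=> FP; apply: hpF; rewrite in_setD1 nF.
move=> _ /andP[j0 jd].
have Iq i : fy_ideal (val F0) (above (val F0)) (sigma F0 h e)`_i.
  have [id|di] := ltnP i d; first exact: (fy_step_coef upP1 F0P1 P1B F0B aboveF0 Ie).
  by rewrite nth_default ?(leq_trans size_q) //; apply: (is_ideal0 (fy_is_ideal _ _)).
(* Shifting back by [h] turns the powers of ['X - h%:P] into powers of ['X], whose coefficients are
   the [p F0 j] themselves. *)
have := comp_poly_coef_ideal ('X + h%:P) (fy_is_ideal _ _) Iq j.
rewrite seE comp_polyD comp_polyC coefD coefC gtn_eqF // add0r.
rewrite (_ : _ \Po _ = \sum_(1 <= i < d) p F0 i *: 'X^i); last first.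
  rewrite linear_sum; apply: eq_bigr => i _; rewrite /= comp_polyZ rmorphXn /=.
  by rewrite comp_polyB comp_polyX comp_polyC addrK.
rewrite coef_sum (bigD1_seq j) ?iota_uniq ?mem_index_iota ?j0 //=.
rewrite coefZ coefXn eqxx mulr1 big1 ?addr0 // => i nij.
by rewrite coefZ coefXn eq_sym (negPf nij) mulr0.
Qed.

(* A step [(F, j)] is the power [x F ^+ j] of the least flat of a chain above [B]. *)
Definition fy_steps B k : seq (fl * nat) :=
  [seq (F, j) | F <- enum (above B),
                j <- [seq j <- index_iota 1 (rk (val F) - rk B) | (j <= k)%N]].

(* [f] is fuel; [#|~: B|] units suffice. *)
Fixpoint fy_mons (f : nat) B (k : nat) : seq 'X_{1..N} :=
  (if k == 0%N then [:: 0%MM] else [::]) ++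
  if f is f'.+1 then
    [seq (U_(enum_rank t.1) *+ t.2 + m)%MM | t <- fy_steps B k,
                                              m <- fy_mons f' (val t.1) (k - t.2)%N]
  else [::].

Lemma mem_fy_steps B k F j :
  ((F, j) \in fy_steps B k) =
  [&& B \proper val F, (0 < j < rk (val F) - rk B)%N & (j <= k)%N].
Proof.
apply/allpairsPdep/idP.
  move=> [G [i [GB iG [-> ->]]]]; move: GB iG.
  by rewrite mem_enum inE mem_filter mem_index_iota => -> /andP[-> ->].
move=> /and3P[pF hj jk]; exists F, j; split=> //; first by rewrite mem_enum inE.
by rewrite mem_filter jk mem_index_iota.
Qed.

Lemma fy_steps_uniq B k : uniq (fy_steps B k).
Proof.
apply: allpairs_uniq_dep; first exact: enum_uniq.
  by move=> F _; rewrite filter_uniq // iota_uniq.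
by move=> [F i] [G j] _ _ /= [-> ->].
Qed.

Lemma card_above f B F : (#|~: B| <= f.+1)%N -> B \proper val F -> (#|~: val F| <= f)%N.
Proof.
move=> hB pF; rewrite -ltnS; apply: leq_trans hB; apply: proper_card.
by rewrite properC.
Qed.

Lemma fy_mons_spec f B k m : m \in fy_mons f B k -> vars_above B m /\ mdeg m = k.
Proof.
elim: f B k m => [|f IH] B k m; rewrite /= mem_cat => /orP[].
- case: eqP => // ->; rewrite inE => /eqP ->; rewrite mdeg0; split=> // G.
  by rewrite mnm0E.
- by [].
- case: eqP => // ->; rewrite inE => /eqP ->; rewrite mdeg0; split=> // G.
  by rewrite mnm0E.
move=> /allpairsPdep[[F j] [m' [/= tB m'F ->]]].
move: tB; rewrite mem_fy_steps => /and3P[pF /andP[j0 _] jk].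
have [va dm] := IH _ _ _ m'F; split=> [G|].
  rewrite mnmDE mulmnE mnm1E (inj_eq enum_rank_inj); case: (F =P G) => [<- //|_].
  by rewrite mul0n add0n => /va; apply: proper_trans.
by rewrite mdegD mdegMn mdeg1 mul1n dm subnKC.
Qed.

(** The first step can be read off a monomial: [F] is the least flat of its support and [j] the
    exponent there, because all later variables belong to flats strictly above [F]. *)
Lemma fy_mons_uniq f B k : uniq (fy_mons f B k).
Proof.
elim: f B k => [|f IH] B k /=; first by rewrite cats0; case: ifP.
have hU F j (m : 'X_{1..N}) G : vars_above (val F) m ->
    (U_(enum_rank F) *+ j + m)%MM (enum_rank G) =
    if F == G then j else m (enum_rank G).
  move=> va; rewrite mnmDE mulmnE mnm1E (inj_eq enum_rank_inj); case: (F =P G) => [<-|_ //].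
  rewrite mul1n; have [->|/va] := eqVneq (m (enum_rank F)) 0%N; first by rewrite addn0.
  by rewrite properxx.
rewrite cat_uniq; apply/and3P; split; first by case: ifP.
  apply/hasPn=> m /allpairsPdep[[F j] [m' [/= tB m'F ->]]]; case: ifP => // _.
  rewrite inE; apply/eqP => /mnmP/(_ (enum_rank F)).
  rewrite hU ?eqxx ?mnm0E; last by case: (fy_mons_spec m'F).
  by move=> j0; move: tB; rewrite mem_fy_steps j0 andbF.
apply: allpairs_uniq_dep; [exact: fy_steps_uniq | by [] |].
move=> [[F j] m] [[F' j'] m'] /= /allpairsPdep[[F1 j1] [m1 [/= t1 h1]]].
move=> /(congr1 (fun p => (tag p, tagged p : 'X_{1..N}))) /= [? ? ?]; subst F1 j1 m1.
move=> /allpairsPdep[[F1 j1] [m1 [/= t2 h2]]].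
move=> /(congr1 (fun p => (tag p, tagged p : 'X_{1..N}))) /= [? ? ?]; subst F1 j1 m1.
move=> /mnmP E; have [va _] := fy_mons_spec h1; have [va' _] := fy_mons_spec h2.
move: t1 t2; rewrite !mem_fy_steps => /and3P[_ /andP[j0 _] _] /and3P[_ /andP[j0' _] _].
(* If the two least flats differed, each would lie strictly above the other. *)
have EF : F = F'.
  apply: contraTeq isT => nF; have := E (enum_rank F); have := E (enum_rank F').
  rewrite !hU // !eqxx (negPf nF) eq_sym (negPf nF) => e1 e2.
  have := va F'; rewrite e1 -lt0n j0' => /(_ isT) p1.
  have := va' F; rewrite -e2 -lt0n j0 => /(_ isT) /(proper_trans p1).
  by rewrite properxx.
have Ej : j = j' by have := E (enum_rank F); rewrite !hU // EF eqxx.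
subst F' j'; congr existT; apply/mnmP => i; have := E i.
by rewrite !mnmDE => /addnI.
Qed.

(** Grouping the monomials by their first step gives the shape required by [fy_peel]. Each group is
    then a relation in the interval above its flat, where induction applies. *)
Lemma fy_mons_free f B k (c : 'X_{1..N} -> rat) : flat B -> (#|~: B| <= f)%N ->
  fy_ideal B (above B) (\sum_(m <- fy_mons f B k) c m *: 'X_[m]) ->
  forall m, m \in fy_mons f B k -> c m = 0.
Proof.
elim: f B k c => [|f IH] B k c fB hB.
  have E : above B = set0.
    apply/setP=> F; rewrite inE in_set0; apply/negP => /properP[_ [i _]].
    by move: hB; rewrite leqn0 cards_eq0 => /eqP/setP/(_ i); rewrite !inE => /negbFE ->.
  rewrite /= cats0 E; case: eqP => // _; rewrite big_seq1 => /fy_ideal0_const.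
  rewrite mcoeffZ mcoeffX eqxx mulr1 => c0 m; by rewrite inE => /eqP ->.
pose p F j : S := if (j <= k)%N then
  \sum_(m <- fy_mons f (val F) (k - j)%N) c (U_(enum_rank F) *+ j + m)%MM *: 'X_[m] else 0.
have -> : \sum_(m <- fy_mons f.+1 B k) c m *: 'X_[m] =
    (if k == 0%N then c 0%MM else 0)%:MP + \sum_(F in above B)
      \sum_(1 <= j < rk (val F) - rk B) x F ^+ j * p F j :> S.
  rewrite /= big_cat; congr (_ + _).
    by case: eqP => _; rewrite ?big_seq1 ?big_nil ?mpolyC0 // mpolyX0 -alg_mpolyC.
  rewrite big_allpairs_dep /= big_allpairs_dep /= big_enum; apply: eq_bigr => F _.
  rewrite big_filter [RHS]big_nat [LHS]big_nat_cond [LHS]big_mkcond [RHS]big_mkcond /=.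
  apply: eq_bigr => j _; case: ifP => [/andP[-> jk]|].
    rewrite /p jk mulr_sumr; apply: eq_bigr => m _.
    by rewrite mpolyXD -mpolyXn -scalerAr.
  by case: ifP => //= _ jk; rewrite /p jk mulr0.
move=> /(fy_peel fB (@above_up _ _) (fun _ => id)) [].
  move=> F j m _; rewrite /p; case: ifP => jk; last by rewrite msupp0.
  move=> /msupp_sum_le; rewrite filter_predT => /flattenP[s /mapP[m' m'F ->]].
  by move/msuppZ_le; rewrite msuppX inE => /eqP ->; case: (fy_mons_spec m'F).
move=> c0 hp m; rewrite /= mem_cat => /orP[|/allpairsPdep[[F j] [m' [/= tB m'F ->]]]].
  by move: c0; case: eqP => // _ <-; rewrite inE => /eqP ->.
move: tB; rewrite mem_fy_steps => /and3P[pF hj jk].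
have := hp F j; rewrite inE pF hj /p jk => /(_ isT isT).
move=> /(IH _ _ (fun m => c (U_(enum_rank F) *+ j + m)%MM) (val_flat F)) h.
by apply: (h (card_above hB pF)).
Qed.

End FYBasis.

Lemma mem_ideal_gen (A : comNzRingType) (gens : seq A) g :
  g \in gens -> g \in ideal_gen gens.
Proof.
move=> gin; apply/ideal_genP.
have ltg : (index g gens < size gens)%N by rewrite index_mem.
exists (fun i => (i == Ordinal ltg)%:R); rewrite (bigD1 (Ordinal ltg)) //= eqxx mul1r.
by rewrite nth_index // big1 ?addr0 // => i /negPf ->; rewrite mul0r.
Qed.

(** * The monomial basis of the Chow ring *)

Section ChowBasis.

Variable M : matroid.
Hypothesis loopless : forall i : M, rk [set i] = 1%N.

Local Notation fl := (nonempty_flat M).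
Local Notation N := #|{: nonempty_flat M}|.
Local Notation S := {mpoly rat[N]}.
Local Notation x := (@flat_var M).
Local Notation h := (@hsum M setT).
Local Notation mons := (@fy_mons M #|M| set0).

Implicit Types (A B : {set M}) (F G H : fl) (P : {set fl}).

Definition in_chow (p : S) : Prop := (p : chow_poly_ring M) \in @chow_ideal M.

Lemma chow_is_ideal : is_ideal in_chow.
Proof.
have [h0 hB] := ideal_gen_zmod (chow_gens_I M ++ chow_gens_J M).
split=> // [p q hp hq|a p hp]; last exact: ideal_genM.
have -> : p + q = p - (0 - q) by rewrite sub0r opprK.
by apply: (hB) => //; apply: (hB).
Qed.
Hint Resolve chow_is_ideal : core.

Lemma chow_inc F G : incomparable (val F) (val G) -> in_chow (x F * x G).
Proof.
move=> inc; apply: mem_ideal_gen; rewrite mem_cat; apply/orP; left.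
apply/mapP; exists (F, G) => //; rewrite mem_filter mem_enum /= inc !andbT.
move: inc; rewrite /incomparable => /andP[nFG nGF]; apply/andP; split.
  by apply: contraNneq nGF => E; rewrite (E : val F = setT) subsetT.
by apply: contraNneq nFG => E; rewrite (E : val G = setT) subsetT.
Qed.

Lemma chow_atom i : in_chow (h [set i]).
Proof.
apply: mem_ideal_gen; rewrite mem_cat; apply/orP; right; apply/mapP; exists i.
  by rewrite mem_enum.
by apply: eq_bigl => F; rewrite in_setT sub1set.
Qed.

Lemma flat0 : flat (set0 : {set M}).
Proof.
apply/flatP => i _; rewrite setU0 loopless ltnS.
by have := rk_le_card (set0 : {set M}); rewrite cards0.
Qed.

Lemma rk0 : rk (set0 : {set M}) = 0%N.
Proof. by have := rk_le_card (set0 : {set M}); rewrite cards0; case: (rk _). Qed.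

Lemma above0 : above (set0 : {set M}) = setT.
Proof. by apply/setP=> F; rewrite !inE proper0 val_nonempty. Qed.

(** Only this inclusion is needed for independence. The linear relation of [j] is the base relation
    of the closure of [j], whose exponent is 1 because there are no loops. *)
Lemma chow_sub_fy p : in_chow p -> fy_ideal set0 (above set0) p.
Proof.
have idI := fy_is_ideal (set0 : {set M}) (above set0).
case/ideal_genP=> c ->; apply: (ideal_sum idI) => i _; apply: (is_idealM idI).
have /(mem_nth 0) := ltn_ord i; rewrite mem_cat => /orP[/mapP[[F G]]|/mapP[j _ ->]].
  rewrite mem_filter => /andP[/and3P[_ _ inc] _] ->.
  by apply/generated_gen/FyInc; rewrite ?above0 ?inE.
have [|J JE] := @mclosure_nonempty_flat M [set j]; first by apply/set0Pn; exists j; rewrite inE.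
have := @FyBase M set0 (above set0) J; rewrite above0 in_setT => /(_ isT) /generated_gen.
rewrite JE rk_mclosure loopless rk0 subn0 expr1 hsum_mclosure -above0.
suff -> : hsum (above set0) [set j] = \sum_(F : fl | j \in val F) chow_var F by [].
by apply: eq_bigl => F; rewrite above0 in_setT sub1set.
Qed.

(* Treats the relations rooted at the empty flat ([u = 1]) and at a flat ([u = x F]) together. *)
Definition anchored (u : S) B := flat B /\ forall i, i \notin B -> in_chow (u * h (i |: B)).

Lemma anchored1 : anchored 1 set0.
Proof. by split=> [|i _]; [exact: flat0 | rewrite mul1r setU0; apply: chow_atom]. Qed.

Lemma anchored_var F : anchored (x F) (val F).
Proof.
split=> [|i niF]; first exact: val_flat.
have hF : in_chow (x F * (h [set i] - h (val F :|: [set i]))).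
  apply: mul_hsum => //; [by move=> ? ? _ _; apply: chow_inc | by rewrite sub1set].
have := idealB chow_is_ideal (is_idealM chow_is_ideal (x F) (chow_atom i)) hF.
by rewrite -mulrBr subKr setUC.
Qed.

(** For [i] in [A] but not in [B], the relation [u * h (i |: B)] expresses one factor
    [u * h (A :|: B)] as minus the sum of [u * x H] over the flats [H] that contain [i |: B] but not
    [A]. Each such [x H] is an anchor at [H], from which the rank distance to [A] is smaller by at
    least one. *)
Lemma anchored_rel k u B A : anchored u B -> ~~ (A \subset B) ->
  (rk (A :|: B) - rk B <= k)%N -> in_chow (u * h (A :|: B) ^+ k).
Proof.
elim: k u B A => [|k IH] u B A [fB hu] nAB.
  by have := flat_rk_ltU fB nAB; rewrite setUC => h1 h2; exfalso; lia.
move=> hk; case/subsetPn: (nAB) => i iA niB.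
have E : h (i |: B) = h (A :|: B) +
    \sum_(H : fl | (i |: B \subset val H) && ~~ (A \subset val H)) x H.
  rewrite /hsum (bigID (fun H => A \subset val H)) /=; congr (_ + _); apply: eq_bigl => H.
    rewrite !in_setT !subUset sub1set /= andbC; case sA: (A \subset val H) => //=.
    by rewrite (subsetP sA).
  by rewrite !in_setT.
have -> : u * h (A :|: B) ^+ k.+1 = h (A :|: B) ^+ k * (u * h (i |: B)) -
    \sum_(H : fl | (i |: B \subset val H) && ~~ (A \subset val H)) u * (x H * h (A :|: B) ^+ k).
  rewrite E -mulr_sumr -mulr_suml exprS.
  by move: (\sum_(H | _) _) (h _) => s t; ring.
apply: idealB => //; first by apply: is_idealM => //; apply: hu.
apply: ideal_sum => // H /andP[sH nAH]; apply: is_idealM => //.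
move: sH; rewrite subUset sub1set => /andP[iH sBH].
have nH : ~~ (A :|: B \subset val H) by rewrite subUset negb_and nAH.
apply: (ideal_congrX chow_is_ideal (v := h (val H :|: (A :|: B)))).
  by apply: mul_hsum => // ? ? _ _; apply: chow_inc.
rewrite setUC; apply: IH => //; first exact: anchored_var.
have := @rkU_sub M (i |: B) (A :|: B) (val H).
rewrite subUset sub1set inE iA subsetUr subUset sub1set iH sBH => /(_ isT isT).
by have /flatP/(_ i niB) := fB; lia.
Qed.

Lemma anchored_flat u B G : anchored u B -> B \proper val G ->
  in_chow (u * h (val G) ^+ (rk (val G) - rk B)).
Proof.
move=> au pBG; have /setUidPl E := proper_sub pBG; rewrite -{1}E; apply: anchored_rel => //.
  exact: proper_subn.
by rewrite E.
Qed.

(** Termination measure of the reduction: rewriting moves exponents to larger flats, and in a fixed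
    degree the weight is bounded. *)
Definition mon_weight (m : 'X_{1..N}) : nat := \sum_(i < N) m i * #|val (enum_val i)|.

Lemma mon_weightD m1 m2 : mon_weight (m1 + m2)%MM = (mon_weight m1 + mon_weight m2)%N.
Proof. by rewrite /mon_weight -big_split; apply: eq_bigr => i _; rewrite mnmDE mulnDl. Qed.

Lemma mon_weightU F j : mon_weight (U_(enum_rank F) *+ j)%MM = (j * #|val F|)%N.
Proof.
rewrite /mon_weight (bigD1 (enum_rank F)) //= mulmnE mnm1E eqxx mul1n enum_rankK big1 ?addn0 //.
by move=> i ni; rewrite mulmnE mnm1E eq_sym (negPf ni).
Qed.

Lemma mon_weight_leq m : (mon_weight m <= mdeg m * #|M|)%N.
Proof.
by rewrite mdegE big_distrl /=; apply: leq_sum => i _; rewrite leq_mul2l max_card orbT.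
Qed.

Definition heavy k w (p : S) := forall m, m \in msupp p -> mdeg m = k /\ (w <= mon_weight m)%N.

Lemma heavyD k w p q : heavy k w p -> heavy k w q -> heavy k w (p + q).
Proof. by move=> hp hq m /msuppD_le; rewrite mem_cat => /orP[/hp|/hq]. Qed.

Lemma heavy0 k w : heavy k w 0.
Proof. by move=> m; rewrite msupp0. Qed.

Lemma heavyN k w p : heavy k w p -> heavy k w (- p).
Proof. by move=> hp m; rewrite (perm_mem (msuppN p)); apply: hp. Qed.

Lemma heavyM k w l v p q : heavy k w p -> heavy l v q -> heavy (k + l) (w + v) (p * q).
Proof.
move=> hp hq m /msuppM_le/allpairsP[[m1 m2] [/= /hp[<- h1] /hq[<- h2] ->]].
by rewrite mdegD mon_weightD leq_add.
Qed.

Lemma heavyX m : heavy (mdeg m) (mon_weight m) 'X_[m].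
Proof. by move=> m'; rewrite msuppX inE => /eqP ->. Qed.

Lemma heavyW k w v p : (v <= w)%N -> heavy k w p -> heavy k v p.
Proof. by move=> vw hp m /hp[-> /(leq_trans vw)]. Qed.

Lemma heavy_var F : heavy 1 #|val F| (x F).
Proof.
have := @heavyX U_(enum_rank F)%MM; rewrite mdeg1.
by have := mon_weightU F 1; rewrite mulm1n mul1n => ->.
Qed.

(** [x G ^+ d] is the lightest term of the power: every other term has a factor [x H] with [H]
    strictly larger than [G]. *)
Lemma heavy_hpow G d : heavy d (d * #|val G|).+1 (h (val G) ^+ d - x G ^+ d).
Proof.
pose t : S := \sum_(H : fl | (val G \subset val H) && (H != G)) x H.
have hE : h (val G) = x G + t.
  by rewrite /hsum (bigD1 G) /= ?in_setT ?subxx //; congr (_ + _); apply: eq_bigl => H; rewrite in_setT.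
have ht : heavy 1 #|val G|.+1 t.
  rewrite /t; elim/big_rec: _ => [|H p /andP[sGH nH] hp]; first exact: heavy0.
  apply: heavyD => //; apply: heavyW (@heavy_var H); apply: proper_card.
  by rewrite properEneq sGH andbT (inj_eq val_inj) eq_sym.
have hh : heavy 1 #|val G| (h (val G)).
  by rewrite hE; apply: heavyD (@heavy_var G) _; apply: heavyW ht.
elim: d => [|d IH]; first by rewrite !expr0 subrr; apply: heavy0.
have hx : heavy d (d * #|val G|) (x G ^+ d).
  by have := @heavyX (U_(enum_rank G) *+ d)%MM; rewrite mdegMn mdeg1 mul1n mon_weightU mpolyXn.
have -> : h (val G) ^+ d.+1 - x G ^+ d.+1 =
    h (val G) * (h (val G) ^+ d - x G ^+ d) + t * x G ^+ d.
  by rewrite !exprS mulrBr -addrA; congr (_ + _); rewrite hE mulrDl opprD addrNK.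
apply: heavyD; apply: (@heavyW _ (#|val G| + (d * #|val G|).+1)).
- by rewrite mulSn addnS.
- exact: heavyM hh IH.
- by rewrite mulSn addnS.
- by rewrite addnS -addSn; apply: heavyM ht hx.
Qed.

(** The flat of least cardinality in the support lies below all others by the chain condition. Its
    power is the first step, and the quotient satisfies the same conditions above it. *)
Lemma fy_mons_mem f B (m : 'X_{1..N}) : (#|~: B| <= f)%N -> vars_above B m ->
  (forall F G, m (enum_rank F) != 0%N -> m (enum_rank G) != 0%N ->
     ~~ incomparable (val F) (val G)) ->
  (forall G, m (enum_rank G) != 0%N -> (m (enum_rank G) < rk (val G) - rk B)%N) ->
  (forall F G, m (enum_rank F) != 0%N -> m (enum_rank G) != 0%N -> val F \proper val G ->
     (m (enum_rank G) < rk (val G) - rk (val F))%N) ->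
  m \in fy_mons f B (mdeg m).
Proof.
elim: f B m => [|f IH] B m hB va chain hbase hrel.
  have -> : m = 0%MM.
    apply/mnmP => i; rewrite mnm0E -(enum_valK i); apply/eqP/negPn/negP => /va.
    move=> /properP[_ [j _]].
    by move: hB; rewrite leqn0 cards_eq0 => /eqP/setP/(_ j); rewrite !inE => /negbFE ->.
  by rewrite mdeg0 /= inE.
have [->|nm] := eqVneq m 0%MM; first by rewrite mdeg0 /= mem_head.
have [i mi] : exists i, m i != 0%N.
  apply/existsP; apply: contraNT nm; rewrite negb_exists => /forallP m0.
  by apply/eqP/mnmP => i; rewrite mnm0E; apply/eqP/negPn.
pose Q G := m (enum_rank G) != 0%N.
have QF1 : Q (enum_val i) by rewrite /Q enum_valK.
case: (arg_minnP (fun F : fl => #|val F|) QF1) => G QG Gmin {i mi QF1}.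
rewrite /= mem_cat; apply/orP; right.
set j := m (enum_rank G).
have mE : m = (U_(enum_rank G) *+ j + (m - U_(enum_rank G) *+ j))%MM.
  apply/mnmP => i; rewrite mnmDE mnmBE mulmnE mnm1E; case: eqP => [<-|_].
    by rewrite mul1n subnn addn0.
  by rewrite mul0n subn0.
set m' := (m - _)%MM in mE.
have m'E F : m' (enum_rank F) = if F == G then 0%N else m (enum_rank F).
  rewrite mnmBE mulmnE mnm1E (inj_eq enum_rank_inj) eq_sym; case: (F =P G) => [->|_].
    by rewrite mul1n subnn.
  by rewrite mul0n subn0.
have dm : mdeg m' = (mdeg m - j)%N by have := congr1 (@mdeg _) mE; rewrite mdegD mdegMn mdeg1; lia.
have pG : forall F, m' (enum_rank F) != 0%N -> Q F /\ val G \proper val F.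
  move=> F; rewrite m'E; case: (F =P G) => // nF QF; split=> //.
  have := chain F G QF QG; rewrite /incomparable negb_and !negbK => /orP[sFG|sGF].
    by case: nF; apply/val_inj/eqP; rewrite eqEcard sFG Gmin.
  rewrite properEneq sGF andbT; apply/eqP => /val_inj E; by case: nF.
have jn0 : (0 < j)%N by rewrite lt0n; exact: QG.
have jm : (j <= mdeg m)%N by have := congr1 (@mdeg _) mE; rewrite mdegD mdegMn mdeg1; lia.
apply/allpairsPdep; exists (G, j), m'; split=> //=.
  by rewrite mem_fy_steps va // jn0 (hbase _ QG).
rewrite -dm; apply: IH.
- by apply: card_above hB _; apply: va.
- by move=> F /pG[].
- by move=> F1 F2 /pG[q1 _] /pG[q2 _]; apply: chain.
- move=> F mF; have [QF pF] := pG _ mF; move: mF; rewrite m'E; case: (F =P G) => // _ mF.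
  exact: hrel.
- move=> F1 F2 m1 m2 p12; have [q1 _] := pG _ m1; have [q2 _] := pG _ m2.
  by move: m2; rewrite m'E; case: (F2 =P G) => // _ _; apply: hrel.
Qed.

Definition spanned k (p : S) := exists c : 'X_{1..N} -> rat,
  in_chow (p - \sum_(m <- mons k) c m *: 'X_[m]).

Lemma spanned_congr k p q : in_chow (p - q) -> spanned k q -> spanned k p.
Proof.
move=> hpq [c hc]; exists c; have := is_idealD chow_is_ideal hpq hc.
by rewrite addrA subrK.
Qed.

Lemma spanned0 k : spanned k 0.
Proof.
exists (fun=> 0); rewrite big1 ?subrr; first exact: is_ideal0.
by move=> m _; rewrite scale0r.
Qed.

Lemma spannedD k p q : spanned k p -> spanned k q -> spanned k (p + q).
Proof.
move=> [c hc] [e he]; exists (fun m => c m + e m).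
under eq_bigr => m _ do rewrite scalerDl.
by rewrite big_split /= opprD addrACA; apply: is_idealD.
Qed.

Lemma spannedZ k a p : spanned k p -> spanned k (a *: p).
Proof.
move=> [c hc]; exists (fun m => a * c m).
under eq_bigr => m _ do rewrite -scalerA.
by rewrite -scaler_sumr -scalerBr -mul_mpolyC; apply: is_idealM.
Qed.

Lemma spanned_heavy k w p :
  (forall m, mdeg m = k -> (w <= mon_weight m)%N -> spanned k 'X_[m]) ->
  heavy k w p -> spanned k p.
Proof.
move=> hX hp; rewrite (mpolyE p) big_seq.
apply: (big_ind (spanned k)); [exact: spanned0 | exact: spannedD |].
by move=> m /hp[dm wm]; apply/spannedZ/hX.
Qed.

(** The relation replaces the factor [x G ^+ d] by terms of the same degree and larger weight. The
    monomial [mu] is the anchor of the relation: 1 or a single variable. *)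
Lemma spanned_step k m mu G d : mdeg m = k -> (mu + U_(enum_rank G) *+ d <= m)%MM ->
  in_chow ('X_[mu] * h (val G) ^+ d) ->
  (forall m', mdeg m' = k -> (mon_weight m < mon_weight m')%N -> spanned k 'X_[m']) ->
  spanned k 'X_[m].
Proof.
move=> dm /submK; set m' := (m - _)%MM => mE hG hX.
have XE : 'X_[m] = 'X_[m'] * ('X_[mu] * x G ^+ d) :> S by rewrite -mE !mpolyXD mpolyXn.
apply: (@spanned_congr _ _ (- ('X_[m'] * 'X_[mu] * (h (val G) ^+ d - x G ^+ d)))).
  rewrite XE opprK (_ : _ + _ = 'X_[m'] * ('X_[mu] * h (val G) ^+ d)); last by ring.
  exact: is_idealM.
apply: (spanned_heavy hX); apply: heavyN; rewrite -mpolyXD.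
have -> : k = (mdeg (m' + mu)%MM + d)%N.
  by rewrite -dm -[in LHS]mE !mdegD mdegMn mdeg1 mul1n addnA.
have -> : (mon_weight m).+1 = (mon_weight (m' + mu)%MM + (d * #|val G|).+1)%N.
  by rewrite -[in LHS]mE !mon_weightD mon_weightU addnS !addnA.
exact: heavyM (@heavyX _) (@heavy_hpow _ _).
Qed.

(** By induction on the gap between the weight and its upper bound. A monomial with two incomparable
    flats is zero, one with too large an exponent is rewritten into heavier ones, and any other is a
    basis monomial. *)
Lemma spannedX (m : 'X_{1..N}) : spanned (mdeg m) 'X_[m].
Proof.
have [w] := ubnP (mdeg m * #|M| - mon_weight m); elim: w m => // w IH m hw.
have IHm m' : mdeg m' = mdeg m -> (mon_weight m < mon_weight m')%N -> spanned (mdeg m) 'X_[m'].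
  by move=> dm wm; rewrite -dm; apply: IH; have := mon_weight_leq m'; rewrite dm; lia.
have leU F d : (d <= m (enum_rank F))%N -> (U_(enum_rank F) *+ d <= m)%MM.
  move=> hd; apply/mnm_lepP => i; rewrite mulmnE mnm1E; case: eqP => [<-|_].
    by rewrite mul1n.
  by rewrite mul0n.
have leUU F d F' d' : F != F' -> (d <= m (enum_rank F))%N -> (d' <= m (enum_rank F'))%N ->
    (U_(enum_rank F) *+ d + U_(enum_rank F') *+ d' <= m)%MM.
  move=> nF hd hd'; apply/mnm_lepP => i; rewrite mnmDE !mulmnE !mnm1E.
  case: (enum_rank F =P i) => [<-|_]; case: (enum_rank F' =P _) => [E|_].
  - by move/enum_rank_inj: E nF => ->; rewrite eqxx.
  - by rewrite mul1n mul0n addn0.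
  - by rewrite -E mul1n mul0n.
  - by rewrite !mul0n.
have [/existsP[F /existsP[G /and3P[mF mG inc]]]|chain] := boolP [exists F : fl, exists G : fl,
    [&& m (enum_rank F) != 0, m (enum_rank G) != 0 & incomparable (val F) (val G)]%N].
  apply: (@spanned_congr _ _ 0); last exact: spanned0.
  have nF : F != G by apply: contraTneq inc => ->; rewrite /incomparable subxx.
  have := leUU F 1%N G 1%N nF; rewrite !lt0n !mulm1n => /(_ mF mG) /submK <-.
  by rewrite subr0 !mpolyXD; apply: (is_idealM chow_is_ideal); apply: chow_inc.
have [/existsP[G /andP[mG hG]]|base] := boolP [exists G : fl,
    (m (enum_rank G) != 0) && (rk (val G) <= m (enum_rank G))]%N.
  apply: (@spanned_step _ _ 0%MM G (rk (val G)) erefl) IHm.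
    by rewrite add0m; apply: leU.
  have := anchored_flat (G := G) anchored1; rewrite proper0 val_nonempty rk0 subn0 mpolyX0.
  exact.
have [/existsP[F /existsP[G /and4P[mF mG pFG hG]]]|rel] := boolP [exists F : fl, exists G : fl,
    [&& m (enum_rank F) != 0, m (enum_rank G) != 0, val F \proper val G &
        rk (val G) - rk (val F) <= m (enum_rank G)]%N].
  apply: (@spanned_step _ _ U_(enum_rank F)%MM G (rk (val G) - rk (val F))%N erefl) IHm.
    rewrite -[U_(enum_rank F)%MM]mulm1n; apply: leUU => //; last by rewrite lt0n.
    by apply: contraTneq pFG => ->; rewrite properxx.
  exact: anchored_flat (anchored_var F) pFG.
have min : m \in mons (mdeg m).
  apply: fy_mons_mem.
  - exact: max_card.
  - by move=> G _; rewrite proper0 val_nonempty.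
  - move=> F G mF mG; apply: contra chain => inc.
    by apply/existsP; exists F; apply/existsP; exists G; rewrite mF mG.
  - move=> G mG; rewrite rk0 subn0 ltnNge; apply: contra base => hG.
    by apply/existsP; exists G; rewrite mG.
  - move=> F G mF mG pFG; rewrite ltnNge; apply: contra rel => hG.
    by apply/existsP; exists F; apply/existsP; exists G; rewrite mF mG pFG.
exists (fun m' => (m' == m)%:R); rewrite (bigD1_seq m) ?fy_mons_uniq //= eqxx scale1r.
rewrite big1 ?addr0 ?subrr; first exact: is_ideal0.
by move=> m' /negPf ->; rewrite scale0r.
Qed.

Lemma spanned_homog k p : p \is k.-homog -> spanned k p.
Proof.
move=> /dhomogP hp; apply: (@spanned_heavy k 0); first by move=> m <- _; apply: spannedX.
by move=> m /hp.
Qed.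

Lemma chow_piX_sum k (c : 'I_(size (mons k)) -> rat) :
  \sum_i c i *: chow_pi (M := M) 'X_[nth 0%MM (mons k) i] =
  chow_pi (M := M) (\sum_i c i *: 'X_[nth 0%MM (mons k) i]).
Proof.
rewrite [RHS]rmorph_sum; apply: eq_bigr => i _.
by rewrite -mul_mpolyC [RHS]rmorphM.
Qed.

Theorem chow_piece_dim k : has_dim (@chow_piece M k) (size (mons k)).
Proof.
have piE (p q : S) : (chow_pi (M := M) p = chow_pi (M := M) q) <-> in_chow (p - q).
  by rewrite /chow_pi /in_chow Quotient.idealrBE; split=> /eqP.
exists (fun i => chow_pi (M := M) 'X_[nth 0%MM (mons k) i]); split=> [v|c].
  split=> [[p /spanned_homog[c hc] ->]|[c ->]].
    exists (fun i => c (nth 0%MM (mons k) i)); rewrite chow_piX_sum; apply/piE.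
    by rewrite (big_nth 0%MM) big_mkord in hc.
  exists (\sum_i c i *: 'X_[nth 0%MM (mons k) i]); last exact: chow_piX_sum.
  apply: rpred_sum => i _; apply: rpredZ; rewrite dhomogX.
  by apply/eqP; case: (fy_mons_spec (mem_nth 0%MM (ltn_ord i))) => _.
rewrite chow_piX_sum -(rmorph0 (chow_pi (M := M))) => /piE; rewrite subr0 => hc i.
(* Transports the coefficients from positions in the list to monomials, which is consistent because
   the list has no duplicates. *)
pose c' m := if insub (index m (mons k)) is Some i then c i else 0.
have c'E (j : 'I_(size (mons k))) : c' (nth 0%MM (mons k) j) = c j.
  by rewrite /c' index_uniq ?fy_mons_uniq // valK.
rewrite -c'E; apply: (@fy_mons_free M #|M| set0 k c' flat0 (max_card _)).
  apply: chow_sub_fy; rewrite (big_nth 0%MM) big_mkord.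
  by under eq_bigr => j _ do rewrite c'E.
by apply: mem_nth.
Qed.

End ChowBasis.

(** * Words and the gamma expansion *)

Section Words.

Definition odd_weight (a : nat) : int := 2 * a%:Z - 1.

Fixpoint words n : seq (seq nat) :=
  if n is n'.+1 then [seq a :: s | a <- iota 1 n, s <- words n'] else [:: [::]].

Lemma wordsS n : words n.+1 = [seq a :: s | a <- iota 1 n.+1, s <- words n].
Proof. by []. Qed.

Definition word_weight (s : seq nat) : int := \prod_(a <- s) odd_weight a.

(* [x^des (x+1)^(n-1-2 des)] on words starting with an ascent and without double
   descents, [0] on the others; see [gamma_word_closed]. *)
Fixpoint gamma_word (s : seq nat) : {poly int} :=
  if s is a :: s' then
    if s' is b :: s'' then
      if (a <= b)%N then
        if s'' is d :: _ then
          if (b <= d)%N then ('X + 1) * gamma_word s' else 'X * gamma_word s''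
        else 'X + 1
      else 0
    else 1
  else 1.

Definition esum k : {poly int} := \sum_(1 <= j < k) 'X^j.

Definition indicator (b : bool) : {poly int} := b%:R.

Definition run_sum (s : seq nat) : {poly int} :=
  \sum_(1 <= k < (size s).+1) indicator (sorted leq (take k s)) * gamma_word (drop k s).

(** The contribution of a single word to the right-hand side of [word_poly_rec]; the first term
    accounts for the constant 1 there. *)
Definition weighted_run_sum (s : seq nat) : {poly int} :=
  indicator (sorted leq s) +
  \sum_(1 <= k < (size s).+1) indicator (sorted leq (take k s)) * (esum k * gamma_word (drop k s)).

Lemma indicatorM b c : indicator (b && c) = indicator b * indicator c.
Proof. by case: b; rewrite /indicator /= ?mul1r ?mul0r. Qed.

Lemma sorted_take_cons a b s k : (0 < k)%N ->
  sorted leq (take k.+1 (a :: b :: s)) = (a <= b)%N && sorted leq (take k (b :: s)).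
Proof. by case: k. Qed.

Lemma esum1 : esum 1 = 0. Proof. by rewrite /esum big_geq. Qed.

Lemma esumS k : (0 < k)%N -> esum k.+1 = 'X * (1 + esum k).
Proof.
move=> k0; rewrite /esum big_ltn // big_add1 /= expr1 mulrDr mulr1; congr (_ + _).
by rewrite mulr_sumr; apply: eq_bigr => j _; rewrite exprS.
Qed.

Lemma run_sum1 b : run_sum [:: b] = 1.
Proof. by rewrite /run_sum big_nat1 /= /indicator /= mulr1. Qed.

Lemma run_sum_cons b d s : run_sum (b :: d :: s) = gamma_word (d :: s) + indicator (b <= d)%N * run_sum (d :: s).
Proof.
rewrite {1}/run_sum big_ltn // [take 1 _]/= drop1 mul1r; congr (_ + _).
rewrite big_add1 [_.-1]/= mulr_sumr big_nat [RHS]big_nat; apply: eq_bigr => k /andP[k0 _].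
by rewrite sorted_take_cons // indicatorM mulrA.
Qed.

Lemma weighted_run_sum_cons a b s : weighted_run_sum (a :: b :: s) = indicator (a <= b)%N *
  ('X * weighted_run_sum (b :: s) + 'X * run_sum (b :: s) + (1 - 'X) * indicator (sorted leq (b :: s))).
Proof.
rewrite {1}/weighted_run_sum big_ltn // esum1 mul0r mulr0 add0r big_add1 [_.-1]/=.
set s1 := \sum_(_ <= _ < _) _.
have -> : s1 = indicator (a <= b)%N * ('X * \sum_(1 <= k < (size (b :: s)).+1)
      indicator (sorted leq (take k (b :: s))) * (esum k * gamma_word (drop k (b :: s)))
    + 'X * run_sum (b :: s)).
  rewrite /run_sum -mulrDr -big_split !mulr_sumr /s1 big_nat [RHS]big_nat.
  apply: eq_bigr => k /andP[k0 _]; rewrite sorted_take_cons // indicatorM esumS //.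
  by move: (indicator _) (indicator _) (esum _) (gamma_word _) => p q r t; rewrite /=; ring.
rewrite /weighted_run_sum [sorted leq (a :: b :: s)]/= indicatorM -/(sorted leq (b :: s)).
by move: (\sum_(_ <= _ < _) _) (indicator _) (indicator _) (run_sum _) => p q r t; ring.
Qed.

Lemma gamma_word_run_sum b s : (if s is d :: _ then (b <= d)%N else true) ->
  'X * run_sum (b :: s) + (1 - 'X) * indicator (sorted leq (b :: s)) = gamma_word (b :: s).
Proof.
elim: s b => [|d s IH] b; first by move=> _; rewrite run_sum1 /indicator /=; ring.
move=> bd; rewrite run_sum_cons [sorted _ _]/= indicatorM -/(sorted leq (d :: s)) bd /indicator !mul1r -/(indicator _).
have [hd|] := boolP (if s is e :: _ then (d <= e)%N else true).
  rewrite mulrDr -addrA IH //= bd; case: s hd {IH} => [|e s] /= => [_|->]; ring.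
case: s {IH} => // e s /= /negPf de; rewrite bd de run_sum_cons de /indicator /=; ring.
Qed.

(** After the ascent from [a] to [b], a second ascent makes the last two terms of
    [weighted_run_sum_cons] collapse to [gamma_word (b :: s)], giving the factor ['X + 1]. A descent
    from [b] to [e] kills the first and third terms and leaves ['X * gamma_word (e :: s)]. *)
Lemma gamma_word_runs s : gamma_word s = weighted_run_sum s.
Proof.
case: s => [|a s]; first by rewrite /weighted_run_sum big_geq // addr0.
elim: s a => [|b s IH] a.
  by rewrite /weighted_run_sum big_nat1 esum1 mul0r mulr0 addr0.
rewrite weighted_run_sum_cons -IH -addrA; case ab: (a <= b)%N; last by rewrite /indicator mul0r /= ab.
rewrite /indicator mul1r -/(indicator _).
have [hb|] := boolP (if s is e :: _ then (b <= e)%N else true).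
  by rewrite gamma_word_run_sum //= ab; case: s hb {IH} => [|e s] /= => [_|->]; ring.
case: s {IH} => // e s /= /negPf be; rewrite ab be run_sum_cons be /indicator /=; ring.
Qed.

(* Total weight of the weakly increasing words of length [l] with letters at least
   [b] and [i]-th letter at most [m + 1 - i]. *)
Fixpoint increasing_weight l b m : int :=
  if l is l'.+1 then \sum_(a <- iota 1 m | (b <= a)%N) odd_weight a * increasing_weight l' a m.-1 else 1.

Arguments increasing_weight : simpl never.

Lemma increasing_weight0 b m : increasing_weight 0 b m = 1.
Proof. by []. Qed.

Lemma increasing_weightS l b m :
  increasing_weight l.+1 b m = \sum_(a <- iota 1 m | (b <= a)%N) odd_weight a * increasing_weight l a m.-1.
Proof. by []. Qed.

(** The bound on a letter depends only on its distance from the end, so what follows a prefix of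
    length [k] is an arbitrary word for [n - k] and the sum factors. *)
Lemma sum_words_split (G : seq nat -> {poly int}) k n b : (k <= n)%N ->
  \sum_(s <- words n) indicator (path leq b (take k s)) * (word_weight s *: G (drop k s)) =
  increasing_weight k b n *: \sum_(s <- words (n - k)) word_weight s *: G s.
Proof.
elim: k n b => [|k IH] n b.
  move=> _; rewrite subn0 increasing_weight0 scale1r; apply: eq_bigr => s _.
  by rewrite take0 drop0 mul1r.
case: n => // n; rewrite ltnS subSS => kn; rewrite wordsS increasing_weightS.
rewrite big_allpairs_dep scaler_suml [RHS]big_mkcond; apply: eq_bigr => a _ /=.
under eq_bigr => s _ do rewrite indicatorM -mulrA /word_weight big_cons -/(word_weight s) -scalerA -scalerAr scalerAr.
rewrite -mulr_sumr; case: ifP => _; last by rewrite mul0r.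
rewrite mul1r -scalerA -IH // scaler_sumr; apply: eq_bigr => s _; by rewrite scalerAr.
Qed.

(** The last letter would have to be at least [b] and at most [m + 1 - l]. *)
Lemma increasing_weight_eq0 l b m : (0 < l)%N -> (m.+1 < b + l)%N -> increasing_weight l b m = 0.
Proof.
elim: l b m => // l IH b m _ hb; rewrite increasing_weightS big_seq_cond big1 // => a.
rewrite mem_iota => /andP[/andP[a1 am] ba].
case: l IH hb => [|l] IH hb; first by exfalso; lia.
by rewrite IH ?mulr0 //; lia.
Qed.

Lemma increasing_weight_rec l b m : (0 < b <= m)%N ->
  increasing_weight l.+1 b m = odd_weight b * increasing_weight l b m.-1 + increasing_weight l.+1 b.+1 m.
Proof.
move=> /andP[b0 bm]; rewrite !increasing_weightS big_mkcond (bigD1_seq b) ?iota_uniq ?mem_iota //=; last by lia.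
rewrite leqnn; congr (_ + _); rewrite [LHS]big_mkcond [RHS]big_mkcond /=.
by apply: eq_bigr => a _; case: ltngtP.
Qed.

(** The last letter is at most 1, so only the word of ones, of weight 1, is counted. *)
Lemma increasing_weight_diag n : increasing_weight n 1 n = 1.
Proof.
elim: n => // n IH; rewrite increasing_weight_rec // IH mulr1 /odd_weight.
by rewrite increasing_weight_eq0 ?addr0.
Qed.

(* Newton interpolation of [z^t] at the consecutive odd numbers [2b+1, 2b+3, ...]. *)
Lemma increasing_weight_newton (z : int) t b :
  \sum_(0 <= l < t.+1) increasing_weight l b.+1 (t + b) * \prod_(i < t - l) (z - odd_weight (b.+1 + i)) = z ^+ t.
Proof.
elim: t b => [|t IH] b; first by rewrite big_nat1 increasing_weight0 big_ord0 mulr1.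
have PS j : \prod_(i < j.+1) (z - odd_weight (b.+1 + i)) =
    (z - odd_weight b.+1) * \prod_(i < j) (z - odd_weight (b.+2 + i)).
  rewrite big_ord_recl addn0; congr (_ * _); apply: eq_bigr => i _.
  by rewrite /= /bump /= add1n addnS addSn.
rewrite big_ltn // big_add1 increasing_weight0 mul1r subn0 PS /=.
have E l : increasing_weight l.+1 b.+1 (t.+1 + b) = odd_weight b.+1 * increasing_weight l b.+1 (t + b) + increasing_weight l.+1 b.+2 (t + b.+1).
  by rewrite increasing_weight_rec ?addSn ?addnS //= ltnS leq_addl.
under [X in _ + X]eq_bigr => l _ do rewrite E mulrDl subSS.
rewrite big_split /= addrCA.
have -> : \sum_(0 <= l < t.+1) odd_weight b.+1 * increasing_weight l b.+1 (t + b) *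
    \prod_(i < t - l) (z - odd_weight (b.+1 + i)) = odd_weight b.+1 * z ^+ t.
  by rewrite -(IH b) mulr_sumr; apply: eq_bigr => l _; rewrite mulrA.
rewrite [X in _ + X](_ : _ = (z - odd_weight b.+1) * z ^+ t); first by rewrite exprS; ring.
(* The top term counts no words; the remaining ones are [z - odd_weight b.+1] times the induction
   hypothesis for [b.+1]. *)
rewrite big_nat_recr //= increasing_weight_eq0 ?mul0r ?addr0 //; last by lia.
rewrite -(IH b.+1) [in RHS]big_ltn // increasing_weight0 mul1r subn0 [in RHS]big_add1 /= mulrDr; congr (_ + _).
rewrite mulr_sumr !big_nat; apply: eq_bigr => l /andP[_ lt].
by rewrite -subSS subSn // PS mulrCA.
Qed.

Definition word_poly n : {poly int} := \sum_(s <- words n) word_weight s *: gamma_word s.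

Lemma wordsP n s : reflect (size s = n /\ forall i, (i < n)%N -> (0 < nth 0%N s i <= n - i)%N)
  (s \in words n).
Proof.
elim: n s => [|n IH] s.
  rewrite /= inE; apply: (iffP eqP) => [->|[/size0nil]] //.
apply: (iffP allpairsPdep) => [[a [s' [ha /IH[sz hs] ->]]]|].
  rewrite /= sz; split=> // -[|i] /=; first by move: ha; rewrite mem_iota; lia.
  by rewrite ltnS subSS; apply: hs.
case: s => [|a s] [] // [sz] hs; exists a, s; split=> //.
  by rewrite mem_iota; have := hs 0%N isT => /=; lia.
by apply/IH; split=> // i hi; have := hs i.+1; rewrite /= subSS; apply.
Qed.

Lemma words_uniq n : uniq (words n).
Proof.
elim: n => // n IH; apply: allpairs_uniq_dep; [exact: iota_uniq | by [] |].
by move=> [a s] [b t] _ _ /= [-> ->].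
Qed.

(** This is the recursion of the Hilbert series, obtained by summing [gamma_word_runs] over all
    words and splitting each at its cut. *)
Lemma word_poly_rec n : word_poly n = 1 + \sum_(1 <= l < n.+1) increasing_weight l 1 n *: (esum l * word_poly (n - l)).
Proof.
have path1 k s : s \in words n -> path leq 1 (take k s) = sorted leq (take k s).
  move=> /wordsP[sz hs]; case: n sz hs => [/size0nil -> //|m] sz hs.
  case: s sz hs => // a s _ /(_ 0%N isT) /= /andP[a1 _]; case: k => //= k.
  by rewrite a1.
rewrite /word_poly; under eq_bigr => s _ do rewrite gamma_word_runs scalerDr.
rewrite big_split /=; congr (_ + _).
  have := @sum_words_split (fun=> 1) n n 1 (leqnn n).
  rewrite increasing_weight_diag scale1r subnn big_seq1 /word_weight big_nil scale1r => <-.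
  rewrite !big_seq; apply: eq_bigr => s hs; rewrite path1 //.
  have /wordsP[<- _] := hs; by rewrite take_size -scalerAr mulr1.
rewrite big_seq.
under eq_bigr => s hs.
  have /wordsP[-> _] := hs; rewrite scaler_sumr.
  under eq_bigr => k _ do rewrite -(path1 _ _ hs) scalerAr.
  over.
rewrite -big_seq exchange_big /= big_nat [RHS]big_nat; apply: eq_bigr => l /andP[_ ln].
rewrite (@sum_words_split (fun s => esum l * gamma_word s)) //; congr (_ *: _).
by rewrite mulr_sumr; apply: eq_bigr => s _; rewrite scalerAr.
Qed.

Definition isolated_descents (s : seq nat) : bool :=
  all (fun i => (entry s i.+1 < entry s i)%N ==> (entry s i.-1 <= entry s i)%N)
      (iota 2 (size s - 2)).

Lemma des_cons a b s : des (a :: b :: s) = ((b < a) + des (b :: s))%N.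
Proof.
rewrite /des [(size (a :: b :: s)).-1]/= [iota 1 _]/= [count _ (_ :: _)]/=.
congr (_ + _)%N; rewrite -[2%N]/(1 + 1)%N iotaDl count_map.
by apply: eq_in_count => -[|i] //; rewrite mem_iota.
Qed.

Lemma isolated_descents_cons a b d s : isolated_descents (a :: b :: d :: s) =
  ((d < b)%N ==> (a <= b)%N) && isolated_descents (b :: d :: s).
Proof.
rewrite /isolated_descents !subn2 [_.-2]/= [(size (b :: d :: s)).-2]/= [iota 2 _.+1]/= [all _ (_ :: _)]/=.
congr (_ && _); rewrite -[3%N]/(1 + 2)%N iotaDl all_map.
by apply: eq_in_all => -[|[|i]] //; rewrite mem_iota.
Qed.

Definition gamma_admissible (s : seq nat) : bool :=
  (if s is a :: b :: _ then (a <= b)%N else true) && isolated_descents s.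

(** The bound on the number of descents is proved alongside, so that the truncated subtraction in
    the exponent is a true one in the induction. *)
Lemma gamma_word_closed s : (0 < size s)%N ->
  gamma_word s = (if gamma_admissible s then 'X ^+ des s * ('X + 1) ^+ (size s - 1 - 2 * des s) else 0) /\
  (gamma_admissible s -> (2 * des s <= size s - 1)%N).
Proof.
have [n] := ubnP (size s); elim: n s => // n IH [|a [|b [|d s]]] // hn _.
- by rewrite /= /gamma_admissible /isolated_descents /= /des /= !expr0 mulr1.
- rewrite /= /gamma_admissible /isolated_descents /= /des /= addn0; case: leqP => /= ab; last by rewrite ?andbF.
  by rewrite mul1r.
rewrite [gamma_word _]/= /gamma_admissible isolated_descents_cons !des_cons.
case ab: (a <= b)%N; last by rewrite /=.
rewrite implybT /= ltnNge ab /= add0n.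
case bd: (b <= d)%N.
  have [|//|] := IH (b :: d :: s); first by rewrite ltnS in hn.
  rewrite /gamma_admissible bd /= !des_cons ltnNge bd /= add0n => -> hle; case: ifP => [hZ|_]; last by rewrite mulr0.
  have := hle hZ; rewrite !subn1 /= => h2; split; last by lia.
  rewrite mulrCA -exprS; congr (_ * _ ^+ _); lia.
have [|//|] := IH (d :: s); first by rewrite ltnS in hn; apply: ltnW.
case: s hn => [|e s] hn.
  by move=> _ _; rewrite ltnNge bd /isolated_descents /des /= expr1.
rewrite /gamma_admissible isolated_descents_cons ltnNge bd !des_cons /= => -> hle.
rewrite [(e < d)%N]ltnNge; case de: (d <= e)%N => /=; last by rewrite mulr0.
rewrite de ltnNge de /= in hle; rewrite [(d < b)%N]ltnNge bd.
case: ifP => [hZ|_]; last by rewrite mulr0.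
have := hle hZ; rewrite !add0n => h2; split; last by lia.
rewrite mulrA -exprS; congr (_ * _ ^+ _); lia.
Qed.

Lemma admissible_words n s : s \in words n -> admissible n s = gamma_admissible s.
Proof.
move=> /wordsP[sz hs]; rewrite /admissible /gamma_admissible /isolated_descents sz.
have -> : all (fun i => (1 <= entry s i <= n.+1 - i)%N) (iota 1 n).
  apply/allP => -[|i]; rewrite mem_iota //= => hi; rewrite /entry subSS; apply: hs; lia.
by congr (_ && _); move: sz; case: s {hs} => [|a [|b s]] /= <-.
Qed.

Lemma admissible_mem_words n s : size s = n -> admissible n s -> s \in words n.
Proof.
move=> sz /and3P[/allP h _ _]; apply/wordsP; split=> // i hi.
by have := h i.+1; rewrite mem_iota /entry subSS; apply; lia.
Qed.

Lemma sum_admissible n : (0 < n)%N ->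
  \sum_(t : n.-tuple 'I_n.+1 | admissible n (map val t))
     (let a := map val t in
      (\prod_(1 <= i < n.+1) (2 * (entry a i)%:Z - 1))
        *: ('X ^+ des a * ('X + 1) ^+ (n - 1 - 2 * des a))) = word_poly n.
Proof.
move=> n0; pose f (a : seq nat) : {poly int} :=
  (\prod_(1 <= i < n.+1) (2 * (entry a i)%:Z - 1))
        *: ('X ^+ des a * ('X + 1) ^+ (n - 1 - 2 * des a)).
transitivity (\sum_(s <- words n | admissible n s) f s); last first.
  rewrite /word_poly big_mkcond !big_seq; apply: eq_bigr => s sw; rewrite admissible_words //.
  have /wordsP[sz hs] := sw.
  have [|-> _] := @gamma_word_closed s; first by rewrite sz.
  rewrite sz; case: ifP => _; last by rewrite scaler0.
  by congr (_ *: _); rewrite /word_weight big_add1 [RHS](big_nth 0%N) sz.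
rewrite -[LHS](big_map (fun t : n.-tuple 'I_n.+1 => map val t) (admissible n) f).
rewrite -[LHS]big_filter -[RHS]big_filter; apply: perm_big; apply: uniq_perm.
- rewrite filter_uniq // map_inj_uniq ?index_enum_uniq // => t1 t2 E.
  by apply/val_inj/(inj_map val_inj).
- by rewrite filter_uniq // words_uniq.
move=> s; rewrite !mem_filter; case: (boolP (admissible n s)) => //= hs; apply/mapP/idP.
  move=> [t _ E]; apply: admissible_mem_words => //; by rewrite E size_map size_tuple.
(* Letters are at most [n], so [inord] into ['I_n.+1] loses nothing. *)
move=> /wordsP[sz h]; have szt : size (map (@inord n) s) == n by rewrite size_map sz.
exists (Tuple szt); first exact: mem_index_enum.
rewrite /= -map_comp map_id_in // => a /(nthP 0%N)[i]; rewrite sz => hi <- /=.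
by rewrite inordK //; have := h i hi; lia.
Qed.

End Words.

(** * Counting basis monomials from the numbers of flats *)

Section CountMonomials.

Variables (M : matroid) (n : nat).
Local Notation fl := (nonempty_flat M).

Hypothesis rk_full : rk [set: M] = n.
Hypothesis card_flats : forall (B : {set M}) l, flat B -> (0 < l <= n - rk B)%N ->
  #|[set F : fl | (B \proper val F) && (rk (val F) == rk B + l)%N]|%:Z
  = increasing_weight l 1 (n - rk B).

Let rk_le (A : {set M}) : (rk A <= n)%N.
Proof. by rewrite -rk_full rk_mono // subsetT. Qed.

Lemma sum_above_rk (B : {set M}) (g : nat -> int) : flat B ->
  \sum_(F in above B) g (rk (val F) - rk B)%N =
  \sum_(1 <= l < (n - rk B).+1) increasing_weight l 1 (n - rk B) * g l.
Proof.
move=> fB; set m := (n - rk B)%N.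
transitivity (\sum_(F in above B) \sum_(1 <= l < m.+1)
    if (rk (val F) - rk B == l)%N then g l else 0).
  apply: eq_bigr => F; rewrite inE => /(flat_rk_proper fB) hF.
  move: (rk_le (val F)) hF; move: (rk (val F)) => r rn Br.
  rewrite (bigD1_seq (r - rk B)%N) ?iota_uniq ?mem_index_iota //=; last by rewrite /m; lia.
  by rewrite eqxx big1 ?addr0 // => l; rewrite eq_sym => /negPf ->.
rewrite exchange_big /= big_nat [RHS]big_nat; apply: eq_bigr => l hl.
rewrite -big_mkcondr (eq_bigl (fun F => F \in
    [set F : fl | (B \proper val F) && (rk (val F) == rk B + l)%N])).
  by rewrite sumr_const -mulr_natl -card_flats // pmulrn intz.
move=> F; rewrite !inE; case pF: (B \proper val F) => //.
by have := rk_mono (proper_sub pF); move: (rk (val F)) => r; lia.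
Qed.

(** Splitting off the first step of a monomial and grouping its flat by relative rank gives the
    recursion [word_poly_rec], coefficient by coefficient. *)
Lemma size_fy_mons f (B : {set M}) k : flat B -> (#|~: B| <= f)%N ->
  (word_poly (n - rk B))`_k = (size (fy_mons f B k))%:Z.
Proof.
elim: f B k => [|f IH] B k fB hB.
  have E : B = setT.
    by apply/setP=> i; move: hB; rewrite leqn0 cards_eq0 => /eqP/setP/(_ i); rewrite !inE => /negbFE ->.
  rewrite E rk_full subnn /word_poly /= big_seq1 /word_weight big_nil scale1r coef1.
  by case: eqP.
have hT : (word_poly (n - rk B))`_k = (k == 0%N)%:Z + \sum_(F in above B)
    \sum_(1 <= j < rk (val F) - rk B | (j <= k)%N) (size (fy_mons f (val F) (k - j)))%:Z.
  rewrite word_poly_rec coefD coef1; congr (_ + _); first by case: eqP.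
  pose g l := \sum_(1 <= j < l | (j <= k)%N) (word_poly (n - rk B - l))`_(k - j).
  transitivity (\sum_(F in above B) g (rk (val F) - rk B)%N).
    rewrite sum_above_rk // coef_sum; apply: eq_bigr => l _; rewrite coefZ; congr (_ * _).
    rewrite /esum mulr_suml coef_sum [RHS]big_mkcond; apply: eq_bigr => j _.
    by rewrite mulrC coefMXn ltnNge; case: leqP.
  apply: eq_bigr => F; rewrite inE => pF; apply: eq_bigr => j _.
  have -> : (n - rk B - (rk (val F) - rk B) = n - rk (val F))%N.
    by have := rk_mono (proper_sub pF); lia.
  by apply: IH (val_flat F) _; apply: card_above hB pF.
rewrite hT /= size_cat PoszD; congr (_ + _); first by case: eqP.
rewrite size_allpairs_dep sumnE big_map /fy_steps big_allpairs_dep big_enum /=.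
rewrite (big_morph _ PoszD (erefl _)); apply: eq_bigr => F _.
by rewrite big_filter (big_morph _ PoszD (erefl _)).
Qed.

End CountMonomials.

(** * The lattice of flats in type B *)

Section TypeB.

Variables (R : realType) (n : nat).

Local Notation V := 'rV[R]_n.
Local Notation M := (typeB_matroid R n).
Local Notation hyps := (hyperplanes (typeB_normals R n)).

Implicit Types (S : {set hyps}) (H : hyps) (v : V).

Lemma mem_arr_cap S v : reflect (forall H, H \in S -> v \in val H) (v \in arr_cap S).
Proof.
rewrite memvE; apply: (iffP subv_bigcapP) => h H /h; first by rewrite memvE.
by rewrite memvE.
Qed.

Definition sgn3 (c : R) := c \in [:: 0; 1; -1].

Lemma sgn3P c : sgn3 c -> [\/ c = 0, c = 1 | c = -1].
Proof.
by rewrite /sgn3 !inE => /or3P[] /eqP; [apply: Or31 | apply: Or32 | apply: Or33].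
Qed.

Lemma sgn3M c e : sgn3 c -> sgn3 e -> sgn3 (c * e).
Proof.
by move=> /sgn3P[] -> /sgn3P[] ->;
  rewrite ?mul0r ?mulr0 ?mul1r ?mulr1 ?mulrNN ?mulr1 /sgn3 !inE eqxx ?orbT.
Qed.

Lemma sum_delta v i : \sum_j v 0 j * (delta_mx 0 i : V) 0 j = v 0 i.
Proof.
rewrite (bigD1 i) //= mxE !eqxx mulr1 big1 ?addr0 // => j ji.
by rewrite mxE (negPf ji) mulr0.
Qed.

(** A uniform shape for the three families of hyperplanes; the coordinate hyperplanes have
    [c = 0]. *)
Lemma hyp_form H : exists i k c, [/\ sgn3 c, c != 0 -> i != k &
  forall v, (v \in val H) <-> v 0 i = c * v 0 k].
Proof.
have /mapP[w hw Hw] := valP H; have mem v : v \in val H <-> \sum_j v 0 j * w 0 j = 0.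
  by rewrite Hw; split=> [/hyperplaneP|h]; last apply/hyperplaneP.
move: hw; rewrite !mem_cat => /or3P[] /mapP.
- move=> [[i k]]; rewrite mem_filter /= => /andP[ik _] E.
  exists i, k, (-1); split; first by rewrite /sgn3 !inE eqxx !orbT.
    by move=> _; rewrite neq_ltn ik.
  move=> v; rewrite mem E; under eq_bigr => j _ do rewrite mxE mulrDr.
  rewrite big_split /= !sum_delta mulN1r; split=> [/eqP|->]; last by rewrite addNr.
  by rewrite addr_eq0 => /eqP.
- move=> [[i k]]; rewrite mem_filter /= => /andP[ik _] E.
  exists i, k, 1; split; first by rewrite /sgn3 !inE eqxx !orbT.
    by move=> _; rewrite neq_ltn ik.
  move=> v; rewrite mem E; under eq_bigr => j _ do rewrite mxE [X in _ + X]mxE mulrBr.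
  rewrite sumrB !sum_delta mul1r; split=> [/eqP|->]; last by rewrite subrr.
  by rewrite subr_eq0 => /eqP.
- move=> [i _ E]; exists i, i, 0; split; first by rewrite /sgn3 !inE eqxx.
    by rewrite eqxx.
  by move=> v; rewrite mem E sum_delta mul0r.
Qed.


Lemma mem_normals w : w \in typeB_normals R n -> exists H, val H = hyperplane w.
Proof.
move=> hw; have hH : hyperplane w \in [seq hyperplane v | v <- typeB_normals R n].
  exact: map_f.
by exists (SeqSub hH).
Qed.

Lemma hyp_coord i : exists H, forall v, (v \in val H) <-> v 0 i = 0.
Proof.
have [|H HE] := @mem_normals (delta_mx 0 i).
  rewrite !mem_cat; apply/or3P; apply: Or33; apply/mapP; exists i => //.
  by rewrite mem_enum.
exists H => v; rewrite HE; split=> [/hyperplaneP|h]; first by rewrite sum_delta.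
by apply/hyperplaneP; rewrite sum_delta.
Qed.

Lemma hyp_sum (i k : 'I_n) : (i < k)%N -> exists H, forall v, (v \in val H) <-> v 0 i = - v 0 k.
Proof.
move=> ik; have [|H HE] := @mem_normals (delta_mx 0 i + delta_mx 0 k).
  rewrite !mem_cat; apply/or3P; apply: Or31; apply/mapP; exists (i, k) => //.
  by rewrite mem_filter /= ik mem_enum.
have E v : \sum_j v 0 j * (delta_mx 0 i + delta_mx 0 k : V) 0 j = v 0 i + v 0 k.
  by under eq_bigr => j _ do rewrite mxE mulrDr; rewrite big_split /= !sum_delta.
exists H => v; rewrite HE; split=> [/hyperplaneP|h].
  by rewrite E => /eqP; rewrite addr_eq0 => /eqP.
by apply/hyperplaneP; rewrite E h addNr.
Qed.

Lemma hyp_diff (i k : 'I_n) : (i < k)%N -> exists H, forall v, (v \in val H) <-> v 0 i = v 0 k.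
Proof.
move=> ik; have [|H HE] := @mem_normals (delta_mx 0 i - delta_mx 0 k).
  rewrite !mem_cat; apply/or3P; apply: Or32; apply/mapP; exists (i, k) => //.
  by rewrite mem_filter /= ik mem_enum.
have E v : \sum_j v 0 j * (delta_mx 0 i - delta_mx 0 k : V) 0 j = v 0 i - v 0 k.
  under eq_bigr => j _ do rewrite mxE [X in _ + X]mxE mulrBr.
  by rewrite sumrB /= !sum_delta.
exists H => v; rewrite HE; split=> [/hyperplaneP|h].
  by rewrite E => /eqP; rewrite subr_eq0 => /eqP.
by apply/hyperplaneP; rewrite E h subrr.
Qed.

Lemma hyp_pair (i k : 'I_n) (c : R) : i != k -> c = 1 \/ c = -1 ->
  exists H, forall v, (v \in val H) <-> v 0 i = c * v 0 k.
Proof.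
rewrite neq_ltn => /orP[ik|ki] [->|->].
- by have [H HE] := hyp_diff ik; exists H => v; rewrite mul1r.
- by have [H HE] := hyp_sum ik; exists H => v; rewrite mulN1r.
- by have [H HE] := hyp_diff ki; exists H => v; rewrite mul1r HE; split=> ->.
- have [H HE] := hyp_sum ki; exists H => v; rewrite mulN1r HE.
  by split=> ->; rewrite opprK.
Qed.

(* The intersection of [S] is parametrized by the coordinates in [D], one for each
   nonzero block: coordinate [i] equals [s i] (a sign or [0]) times coordinate [b i]. *)
Record signed_blocks S (D : {set 'I_n}) (b : 'I_n -> 'I_n) (s : 'I_n -> R) : Prop :=
  SignedBlocks {
    blocks_sgn : forall i, sgn3 (s i);
    blocks_in : forall i, s i != 0 -> b i \in D;
    blocks_rep : forall i, i \in D -> b i = i /\ s i = 1;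
    blocks_cap : forall v, (v \in arr_cap S) <-> (forall i, v 0 i = s i * v 0 (b i));
    blocks_dim : \dim (arr_cap S) = #|D|
  }.

(** This point witnesses that a hyperplane does not contain the whole intersection. *)
Lemma unit_in_cap S D b s k : signed_blocks S D b s -> k \in D ->
  exists2 u : V, u \in arr_cap S &
    u 0 k = 1 /\ forall i, i \in D -> i != k -> u 0 i = 0.
Proof.
move=> bl kD; exists (\row_i (s i * (b i == k)%:R)).
  apply/(blocks_cap bl) => i; rewrite !mxE.
  have [->|/(blocks_in bl) biD] := eqVneq (s i) 0; first by rewrite !mul0r.
  by have [-> ->] := blocks_rep bl biD; rewrite mul1r.
have [bk sk] := blocks_rep bl kD; rewrite mxE bk sk eqxx mulr1; split=> // i iD ik.
by have [bi _] := blocks_rep bl iD; rewrite mxE bi (negPf ik) mulr0.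
Qed.

Lemma arr_cap_setU1 H S : arr_cap (H |: S) = (val H :&: arr_cap S)%VS.
Proof.
apply/vspaceP => v; rewrite memv_cap; apply/mem_arr_cap/andP => [h|[vH /mem_arr_cap vS] G].
  split; first by apply: h; rewrite setU11.
  by apply/mem_arr_cap => G GS; apply: h; rewrite setU1r.
by case/setU1P => [-> //|/vS].
Qed.

Lemma dim_cap_hyp H S v : v \in arr_cap S -> v \notin val H ->
  \dim (arr_cap S) = (\dim (arr_cap (H |: S))).+1.
Proof.
move=> vS vH; rewrite arr_cap_setU1.
have lt : (\dim (val H :&: arr_cap S) < \dim (arr_cap S))%N.
  rewrite ltn_neqAle dimvS ?capvSr // andbT; apply: contra vH => /eqP E.
  have /eqP EE : (val H :&: arr_cap S == arr_cap S)%VS by rewrite eqEdim capvSr E /=.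
  by move: vS; rewrite -EE memv_cap => /andP[].
have := dimv_sum_cap (val H) (arr_cap S).
have := dimvS (subvf (val H + arr_cap S)); rewrite dimvf /dim /= mul1n.
have : (n <= (\dim (val H)).+1)%N.
  by have /mapP[w _ ->] := valP H; apply: dim_hyperplane.
move: lt; move: (\dim _) (\dim _) (\dim _) (\dim _) => x1 x2 x3 x4; lia.
Qed.

(** A hyperplane cutting the intersection properly eliminates the parameter [p]: its block is merged
    into that of [q] with sign [c], or joins the zero block when [c = 0]. *)
Lemma signed_blocks_step S D b s H p q c : signed_blocks S D b s ->
  sgn3 c -> p \in D -> (c != 0 -> q \in D /\ q != p) ->
  (forall v, v \in arr_cap S -> (v \in val H <-> v 0 p = c * v 0 q)) ->
  signed_blocks (H |: S) (D :\ p) (fun i => if b i == p then q else b i)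
                (fun i => if b i == p then s i * c else s i).
Proof.
move=> bl c3 pD hq hH; have [bp sp] := blocks_rep bl pD; split.
- move=> i; have := blocks_sgn bl i; case: ifP => // _ si; exact: sgn3M.
- move=> i; case: ifP => [_|/negbT nb si]; last by rewrite in_setD1 nb (blocks_in bl).
  rewrite mulf_eq0 negb_or => /andP[_ /hq[qD qp]]; by rewrite in_setD1 qp.
- move=> i /setD1P[ip iD]; have [-> ->] := blocks_rep bl iD; by rewrite (negPf ip).
- move=> v; rewrite arr_cap_setU1 memv_cap; split.
    move=> /andP[vH vS] i; have vE := (blocks_cap bl v).1 vS.
    case: eqP => [bi|_] //; rewrite {1}vE bi ((hH v vS).1 vH) mulrA //.
  move=> vE; have vp : v 0 p = c * v 0 q by have := vE p; rewrite bp eqxx sp mul1r.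
  have vS : v \in arr_cap S.
    apply/(blocks_cap bl) => i; have := vE i; case: eqP => [->|_] //.
    by rewrite vp mulrA.
  by rewrite vS andbT; apply/hH.
- have [u uS [up u0]] := unit_in_cap bl pD.
  have uH : u \notin val H.
    apply/negP => /(hH u uS); rewrite up; have [->|/hq[qD qp]] := eqVneq c 0.
      by rewrite mul0r => /eqP; rewrite oner_eq0.
    by rewrite u0 // mulr0 => /eqP; rewrite oner_eq0.
  have := dim_cap_hyp uS uH; rewrite (blocks_dim bl) (cardsD1 p D) pD add1n => -[->] //.
Qed.

Lemma signed_blocks_same S D b s H : signed_blocks S D b s ->
  (forall v, v \in arr_cap S -> v \in val H) -> signed_blocks (H |: S) D b s.
Proof.
move=> bl hH; have E : arr_cap (H |: S) = arr_cap S.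
  apply/vspaceP => v; rewrite arr_cap_setU1 memv_cap; apply/andP/idP => [[] //|vS].
  by split=> //; apply: hH.
case: bl => h1 h2 h3 h4 h5; split=> //; first by move=> v; rewrite E.
by rewrite E.
Qed.

(** On the intersection found so far, the next hyperplane reads [a * v_p = e * v_q] with [a], [e] in
    {0, 1, -1}. It is redundant, kills one block, or merges two blocks, according to which of [a],
    [e] vanish and whether [p = q] and [a = e]. *)
Lemma signed_blocks_exists S : exists D b s, signed_blocks S D b s.
Proof.
have [m] := ubnP #|S|; elim: m S => // m IH S.
have [->|[H HS]] := set_0Vmem S.
  move=> _; exists setT, id, (fun=> 1); split.
  - by move=> i; rewrite /sgn3 !inE eqxx orbT.
  - by move=> i _; rewrite in_setT.
  - by [].
  - move=> v; split=> [_ i|_]; first by rewrite mul1r.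
    by apply/mem_arr_cap => H; rewrite inE.
  - by rewrite /arr_cap big_set0 dimvf /dim /= mul1n cardsT card_ord.
rewrite (cardsD1 H S) HS add1n ltnS => /IH[D [b [s bl]]].
rewrite -(setD1K HS); move: (S :\ H) bl => {HS}S bl.
have [i [k [c [c3 _ HE]]]] := hyp_form H.
have vE v : v \in arr_cap S ->
    (v \in val H <-> s i * v 0 (b i) = (c * s k) * v 0 (b k)).
  by move=> vS; rewrite HE -mulrA -!((blocks_cap bl v).1 vS).
have a3 := blocks_sgn bl i; have e3 := sgn3M c3 (blocks_sgn bl k).
have iD := blocks_in bl (i := i).
have kD : c * s k != 0 -> b k \in D.
  by rewrite mulf_eq0 negb_or => /andP[_]; apply: (blocks_in bl).
move: (s i) (c * s k) (b i) (b k) a3 e3 iD kD vE => a e p q a3 e3 aD eD vE.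
have [a0|a0] := eqVneq a 0; have [e0|e0] := eqVneq e 0.
- exists D, b, s; apply: signed_blocks_same => // v /vE ->; by rewrite a0 e0 !mul0r.
- do 3 eexists; apply: (@signed_blocks_step _ _ _ _ _ q q 0 bl) => //.
  + by rewrite /sgn3 !inE eqxx.
  + exact: eD.
  + by rewrite eqxx.
  + move=> v /vE ->; rewrite a0 !mul0r; split=> [/esym/eqP|->]; last by rewrite mulr0.
    by rewrite mulf_eq0 (negPf e0) => /eqP.
- do 3 eexists; apply: (@signed_blocks_step _ _ _ _ _ p p 0 bl) => //.
  + by rewrite /sgn3 !inE eqxx.
  + exact: aD.
  + by rewrite eqxx.
  + move=> v /vE ->; rewrite e0 !mul0r; split=> [/eqP|->]; last by rewrite mulr0.
    by rewrite mulf_eq0 (negPf a0) => /eqP.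
have aa : a * a = 1.
  by case/sgn3P: a3 a0 => ->; rewrite ?eqxx // ?mulr1 // mulrNN mulr1.
have [pq|pq] := eqVneq p q; last first.
  do 3 eexists; apply: (@signed_blocks_step _ _ _ _ _ p q (a * e) bl).
  + exact: sgn3M.
  + exact: aD.
  + by move=> _; split; [exact: eD | rewrite eq_sym].
  + move=> v /vE ->; rewrite -mulrA; split=> [<-|->]; first by rewrite mulrA aa mul1r.
    by rewrite !mulrA aa mul1r.
have [ae|ae] := eqVneq a e.
  by exists D, b, s; apply: signed_blocks_same => // v /vE ->; rewrite ae pq.
do 3 eexists; apply: (@signed_blocks_step _ _ _ _ _ p p 0 bl) => //.
+ by rewrite /sgn3 !inE eqxx.
+ exact: aD.
+ by rewrite eqxx.
+ move=> v /vE ->; rewrite -pq mul0r; split=> [/eqP|->]; last by rewrite !mulr0.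
  by rewrite -subr_eq0 -mulrBl mulf_eq0 subr_eq0 (negPf ae) => /eqP.
Qed.

Definition point_flat v : {set M} := [set H : hyps | v \in val H].

Lemma sub_point_flat (F : {set M}) v : (F \subset point_flat v) = (v \in arr_cap F).
Proof.
apply/subsetP/mem_arr_cap => h H /h; first by rewrite inE.
by rewrite inE.
Qed.

Lemma point_flat_flat v : flat (point_flat v).
Proof.
apply/flatP => H; rewrite inE => vH; rewrite /rk /= /arr_rk.
have vS : v \in arr_cap (point_flat v) by rewrite -sub_point_flat.
have := dim_cap_hyp vS vH; have := arr_cap_dim (point_flat v).
move: (\dim _) (\dim _) => x1 x2; lia.
Qed.

(** Adding such an [H] leaves the intersection, and so the rank, unchanged. *)
Lemma flat_mem (F : {set M}) H : flat F ->
  (forall v, v \in arr_cap F -> v \in val H) -> H \in F.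
Proof.
move=> /flatP/(_ H) fF hH; apply: contraT => /fF.
rewrite /rk /= /arr_rk arr_cap_setU1 (_ : (val H :&: _)%VS = arr_cap F) ?ltnn //.
apply/vspaceP => v; rewrite memv_cap; apply/andP/idP => [[] //|vS].
by split=> //; apply: hH.
Qed.

(** * Counting lattice points of a box by their smallest flat *)

Section Box.

Variable q : nat.

(* [None] stands for [0] and [Some (a, e)] for [(-1)^e (a + 1)], so a box is {-q..q}. *)
Definition box := option ('I_q * bool).

Definition bval (t : box) : R :=
  if t is Some (a, e) then (-1) ^+ e * (a : nat).+1%:R else 0.

Lemma bval_inj : injective bval.
Proof.
have nz (a : 'I_q) : (a : nat).+1%:R != 0 :> R by rewrite pnatr_eq0.
have pos (a : 'I_q) : 0 < (a : nat).+1%:R :> R by rewrite ltr0n.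
move=> [[a e]|] [[a' e']|] //= /eqP.
- have [<-|ne] := eqVneq e e'.
    rewrite (inj_eq (mulfI _)) ?signr_eq0 // eqr_nat => /eqP[] /val_inj -> //.
  have -> : (-1) ^+ e' = - (-1) ^+ e :> R by case: e e' ne => [] [] //=; rewrite ?expr0 ?expr1 ?opprK.
  rewrite mulNr -subr_eq0 opprK -mulrDr mulf_eq0 signr_eq0 /= gt_eqF //.
  exact: addr_gt0.
- by rewrite mulf_eq0 signr_eq0 (negPf (nz a)).
- by rewrite eq_sym mulf_eq0 signr_eq0 (negPf (nz a')).
Qed.

(** Meant for signs only: any scalar other than 0 and 1 acts as -1. *)
Definition bscale (c : R) (t : box) : box :=
  if c == 0 then None else
  if c == 1 then t else if t is Some (a, e) then Some (a, ~~ e) else None.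

Lemma bvalZ c t : sgn3 c -> bval (bscale c t) = c * bval t.
Proof.
rewrite /bscale; case/sgn3P => ->; rewrite ?eqxx ?oner_eq0 ?mul0r ?mul1r //.
rewrite oppr_eq0 oner_eq0 (lt_eqF (lt_trans (ltrN10 R) ltr01)).
by case: t => [[a []]|] //=; rewrite ?expr0 ?expr1 ?mulN1r ?mul1r ?opprK ?oppr0.
Qed.

Definition bvec (t : {ffun 'I_n -> box}) : V := \row_i bval (t i).

Section Count.

Variables (F : {set M}) (D : {set 'I_n}) (b : 'I_n -> 'I_n) (s : 'I_n -> R).
Hypotheses (fF : flat F) (bl : signed_blocks F D b s).

Local Notation J := {i : 'I_n | i \in D}.

(** The default [None] is harmless: [b i] lies outside [D] only when [s i = 0]. *)
Definition block_ext (g : {ffun J -> box}) : {ffun 'I_n -> box} :=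
  [ffun i => bscale (s i) (if insub (b i) is Some k then g k else None)].

Lemma block_ext_rep g (k : J) : block_ext g (val k) = g k.
Proof.
have [bk sk] := blocks_rep bl (valP k).
by rewrite ffunE sk /bscale oner_eq0 eqxx bk valK.
Qed.

Lemma block_ext_val g i : bvec (block_ext g) 0 i = s i * bvec (block_ext g) 0 (b i).
Proof.
rewrite !mxE; have [s0|si] := eqVneq (s i) 0.
  by rewrite s0 mul0r ffunE /bscale s0 eqxx.
rewrite [X in bval X = _]ffunE bvalZ ?(blocks_sgn bl) //; congr (_ * _).
have biD := blocks_in bl si; rewrite insubT /=.
by have := block_ext_rep g (Sub (b i) biD); rewrite SubK => ->.
Qed.

Lemma block_ext_inj : injective block_ext.
Proof. by move=> g g' E; apply/ffunP => k; rewrite -!block_ext_rep E. Qed.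

Lemma block_extP t : (bvec t \in arr_cap F) <-> exists g, t = block_ext g.
Proof.
split=> [/(blocks_cap bl) tE|[g ->]]; last by apply/(blocks_cap bl) => i; apply: block_ext_val.
exists [ffun k : J => t (val k)]; apply/ffunP => i; apply: bval_inj.
have := tE i; rewrite !mxE => ->; have [s0|si] := eqVneq (s i) 0.
  by rewrite s0 mul0r ffunE /bscale s0 eqxx.
rewrite ffunE bvalZ ?(blocks_sgn bl) //; congr (_ * bval _).
by rewrite insubT ?(blocks_in bl) //= => biD; rewrite ffunE SubK.
Qed.

Lemma card_box : #|{: box}| = (2 * q).+1.
Proof. by rewrite card_option card_prod card_ord card_bool mulnC. Qed.

Lemma card_blocks : #|{: J}| = #|D|.
Proof. by rewrite card_sig. Qed.

Lemma card_points_above :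
  #|[set t | F \subset point_flat (bvec t)]| = ((2 * q).+1 ^ #|D|)%N.
Proof.
have -> : [set t | F \subset point_flat (bvec t)] = [set block_ext g | g : {ffun J -> box}].
  apply/setP => t; rewrite inE sub_point_flat; apply/idP/imsetP => [/block_extP[g ->]|[g _ ->]].
    by exists g.
  by apply/block_extP; exists g.
rewrite card_imset; last exact: block_ext_inj.
by rewrite card_ffun card_box card_blocks.
Qed.

Definition mk_generic (u : {ffun J -> 'I_q} * {ffun J -> bool}) : {ffun J -> box} :=
  [ffun k => Some (u.1 k, u.2 k)].

(** A point of the intersection lies on no further hyperplane exactly when its block parameters are
    nonzero with pairwise distinct absolute values; [u.1] encodes the absolute values and [u.2] the
    signs. *)
Lemma generic_points : [set t | point_flat (bvec t) == F] =
  [set block_ext (mk_generic u) |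
     u in [set u : {ffun J -> 'I_q} * {ffun J -> bool} | injectiveb u.1]].
Proof.
apply/setP => t; rewrite inE; apply/eqP/imsetP; last first.
  move=> [u]; rewrite inE => /injectiveP inj ->; set g := mk_generic u.
  have vS : bvec (block_ext g) \in arr_cap F by apply/block_extP; exists g.
  apply/eqP; rewrite eqEsubset sub_point_flat vS andbT; apply/subsetP => H; rewrite inE => vH.
  apply: flat_mem => // v vF; have [i [k [c [c3 _ HE]]]] := hyp_form H.
  move/HE: vH; rewrite HE (block_ext_val g i) (block_ext_val g k).
  rewrite ((blocks_cap bl v).1 vF i) ((blocks_cap bl v).1 vF k) !mulrA.
  have a3 := blocks_sgn bl i; have e3 := sgn3M c3 (blocks_sgn bl k).
  have iD := blocks_in bl (i := i).
  have kD : c * s k != 0 -> b k \in D.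
    by rewrite mulf_eq0 negb_or => /andP[_]; apply: (blocks_in bl).
  have gE p (pD : p \in D) : bvec (block_ext g) 0 p =
      (-1) ^+ (u.2 (Sub p pD)) * (u.1 (Sub p pD) : nat).+1%:R.
    by rewrite mxE; have := block_ext_rep g (Sub p pD); rewrite SubK => ->; rewrite ffunE.
  have gn0 p : p \in D -> bvec (block_ext g) 0 p != 0.
    by move=> pD; rewrite gE mulf_neq0 ?signr_eq0 // pnatr_eq0.
  move: (s i) (c * s k) (b i) (b k) a3 e3 iD kD => a e p r a3 e3 aD eD.
  have [->|a0] := eqVneq a 0.
    rewrite !mul0r => /esym/eqP; rewrite mulf_eq0; case: eqP => [->|/eqP/eD/gn0/negPf -> //].
    by rewrite !mul0r.
  have pD := aD a0; have [->|e0] := eqVneq e 0.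
    by rewrite !mul0r => /eqP; rewrite mulf_eq0 (negPf a0) (negPf (gn0 _ pD)).
  have rD := eD e0 => E.
  have abs1 z : sgn3 z -> z != 0 -> `|z| = 1 :> R.
    by case/sgn3P => ->; rewrite ?eqxx // ?normr1 // normrN normr1.
  have prE : p = r.
    have := congr1 Num.norm E; rewrite !normrM (abs1 a) // (abs1 e) // !mul1r (gE _ pD) (gE _ rD).
    rewrite !normrM !normr_sign !mul1r !normr_nat => /eqP; rewrite eqr_nat => /eqP[] /val_inj.
    by move/inj/(congr1 val); rewrite !SubK.
  move: E; rewrite prE => /(mulIf (gn0 _ rD)) -> //.
move=> Et; have : bvec t \in arr_cap F by rewrite -sub_point_flat Et.
move=> /block_extP[g tE].
have rep (k : J) : bvec t 0 (val k) = bval (g k) by rewrite mxE tE block_ext_rep.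
have gS k : exists ae, g k = Some ae.
  (* A zero parameter would put a coordinate hyperplane into [F], which the unit point of that block
     refutes. *)
  case E: (g k) => [ae|]; first by exists ae.
  have [H HE] := hyp_coord (val k); have : H \in F.
    by rewrite -Et inE; apply/HE; rewrite rep E.
  have [w wF [wk _]] := unit_in_cap bl (valP k).
  move=> /((mem_arr_cap _ _ wF) H)/HE; rewrite wk => /eqP; by rewrite oner_eq0.
have [f fE] := choice gS.
exists ([ffun k => (f k).1], [ffun k => (f k).2]); last first.
  by rewrite tE; congr block_ext; apply/ffunP => k; rewrite !ffunE fE; case: (f k).
rewrite inE; apply/injectiveP => k k'; rewrite !ffunE => Ef.
apply: contraTeq isT => nk; have nk' : val k != val k' by rewrite (inj_eq val_inj).
(* The ratio of two parameters of equal absolute value; it gives a hyperplane of [F] that misses the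
   unit point of block [k]. *)
pose c : R := (-1) ^+ (f k).2 * (-1) ^+ (f k').2.
have c1 : c = 1 \/ c = -1.
  by rewrite /c; case: (f k).2; case: (f k').2; rewrite ?expr0 ?expr1 ?mulrNN ?mulr1 ?mul1r; auto.
have [H HE] := hyp_pair nk' c1; have : H \in F.
  rewrite -Et inE; apply/HE; rewrite !rep !fE /c /bval.
  case: (f k) (f k') Ef => a e [a' e'] /= ->.
  by rewrite mulrA -[_ * _ * (-1) ^+ e']mulrA -expr2 sqrr_sign mulr1.
have [w wF [wk w0]] := unit_in_cap bl (valP k).
move=> /((mem_arr_cap _ _ wF) H)/HE; rewrite wk w0 ?(valP k') // 1?eq_sym // mulr0.
by move=> /eqP; rewrite oner_eq0.
Qed.

Lemma card_generic_points :
  #|[set t | point_flat (bvec t) == F]| = (2 ^ #|D| * q ^_ #|D|)%N.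
Proof.
rewrite generic_points card_in_imset; last first.
  move=> [f e] [f' e'] _ _ /block_ext_inj/ffunP E.
  by congr pair; apply/ffunP => k; have := E k; rewrite !ffunE => -[].
have -> : [set u : {ffun J -> 'I_q} * {ffun J -> bool} | injectiveb u.1] =
    setX [set f : {ffun J -> 'I_q} | injectiveb f] setT.
  by apply/setP => -[f e]; rewrite !inE andbT.
rewrite cardsX card_inj_ffuns cardsT card_ffun card_bool card_ord card_blocks.
by rewrite mulnC.
Qed.

End Count.

Lemma count_points (F : {set M}) : flat F ->
  (\sum_(G : {set M} | flat G && (F \subset G)) 2 ^ (n - rk G) * q ^_ (n - rk G)
   = (2 * q).+1 ^ (n - rk F))%N.
Proof.
have dimE (G : {set M}) D b s : signed_blocks G D b s -> (n - rk G)%N = #|D|.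
  move=> bl; rewrite -(blocks_dim bl) /rk /= /arr_rk subKn //; exact: arr_cap_dim.
move=> fF; have [D [b [s bl]]] := signed_blocks_exists F.
rewrite (dimE _ _ _ _ bl) -(card_points_above bl) -sum1_card.
rewrite (partition_big (fun t => point_flat (bvec t)) (fun G => flat G && (F \subset G))) /=.
  apply: eq_bigr => G /andP[fG sFG]; have [D' [b' [s' bl']]] := signed_blocks_exists G.
  rewrite (dimE _ _ _ _ bl') -(card_generic_points fG bl') -sum1_card.
  by apply: eq_bigl => t; rewrite !inE; case: eqP => [->|]; rewrite ?sFG ?andbF.
by move=> t; rewrite inE point_flat_flat.
Qed.

End Box.

End TypeB.

(** * The numbers of flats by Newton interpolation *)

Lemma prod_odd_weight (q j : nat) :
  \prod_(i < j) ((2 * q).+1%:Z - odd_weight (1 + i)) = (2 ^ j * q ^_ j)%N%:Z.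
Proof.
elim: j => [|j IH]; first by rewrite big_ord0.
rewrite big_ord_recr /= IH ffactnSr expnS /odd_weight; have [jq|qj] := leqP j q.
  by rewrite (_ : _.+1%:Z - _ = 2 * (q - j)%N%:Z); [rewrite !PoszM; ring | lia].
(* Past [j = q] a zero factor has already occurred, so both sides vanish. *)
by rewrite ffact_small // muln0 mul0n muln0 mul0r.
Qed.

(** The system is triangular: at [q = j] the falling factorials of index above [j] vanish, and the
    coefficients below [j] are zero by induction. *)
Lemma ffact_coef_unique (m : nat) (e : nat -> int) :
  (forall q : nat, \sum_(j < m.+1) e j * (2 ^ j * q ^_ j)%N%:Z = 0) ->
  forall j, (j <= m)%N -> e j = 0.
Proof.
move=> h j; have [k] := ubnP j; elim: k j => // k IH j; rewrite ltnS => jk jm.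
have := h j; rewrite (bigD1 (Ordinal (jm : (j < m.+1)%N))) //= big1 ?addr0.
  by move/eqP; rewrite mulf_eq0 ffactnn eqz_nat muln_eq0 expn_eq0 /= gtn_eqF ?fact_gt0 // orbF => /eqP.
move=> i ni; have [ij|] := ltnP j i; first by rewrite ffact_small // muln0 mulr0.
rewrite leq_eqVlt => /orP[/eqP E|ij].
  by case/negP: ni; apply/eqP/val_inj.
by rewrite IH ?mul0r //; [apply: leq_trans jk | rewrite -ltnS].
Qed.

Section TypeBCount.

Variables (R : realType) (n : nat).
Local Notation M := (typeB_matroid R n).
Local Notation fl := (nonempty_flat M).

Lemma typeB_rk_full : rk [set: M] = n.
Proof.
rewrite /rk /= /arr_rk (_ : arr_cap _ = 0%VS) ?dimv0 ?subn0 //.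
apply/eqP; rewrite -subv0; apply/subvP => v /mem_arr_cap h; rewrite memv0.
apply/eqP/rowP => i; rewrite mxE; have [H HE] := hyp_coord R i.
by apply/HE/h; rewrite in_setT.
Qed.

Lemma typeB_loopless (H : M) : rk [set H] = 1%N.
Proof.
have [i [k [c [_ nik HE]]]] := hyp_form H.
have uH : (delta_mx 0 i : 'rV[R]_n) \notin val H.
  apply/negP => /HE; rewrite !mxE !eqxx /=; have [->|/nik nk] := eqVneq c 0.
    by rewrite mul0r => /eqP; rewrite oner_eq0.
  by rewrite eq_sym (negPf nk) mulr0 => /eqP; rewrite oner_eq0.
have := @dim_cap_hyp R n H set0 (delta_mx 0 i); rewrite setU0 => /(_ _ uH).
rewrite /rk /= /arr_rk => E.
have E0 : \dim (arr_cap (set0 : {set hyperplanes (typeB_normals R n)})) = n.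
  by rewrite /arr_cap big_set0 dimvf /dim /= mul1n.
rewrite -[X in (X - _)%N]E0 E ?subSnn //.
by apply/mem_arr_cap => G; rewrite inE.
Qed.

(** The point count and [increasing_weight_newton] at [z = 2q + 1] both expand [(2q + 1)^m] in the
    same products for every [q], so the coefficients agree. *)
Lemma typeB_card_flats (B : {set M}) l : flat B -> (0 < l <= n - rk B)%N ->
  #|[set F : fl | (B \proper val F) && (rk (val F) == rk B + l)%N]|%:Z
  = increasing_weight l 1 (n - rk B).
Proof.
move=> fB /andP[l0 lm]; set m := (n - rk B)%N in lm *.
have rk_le (A : {set M}) : (rk A <= n)%N by rewrite -[n in (_ <= n)%N]typeB_rk_full rk_mono // subsetT.
(* Unlike the set in the statement, this also counts [B] itself at [k = 0], as the point count
   requires. *)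
pose c k := #|[set G : {set M} | [&& flat G, B \subset G & rk G == rk B + k]%N]|.
have -> : #|[set F : fl | (B \proper val F) && (rk (val F) == rk B + l)%N]| = c l.
  rewrite -(card_imset _ val_inj); apply: eq_card => G; rewrite inE.
  apply/imsetP/and3P => [[F]|[fG sBG rG]].
    rewrite inE => /andP[pF rF] ->; split=> //; [exact: val_flat | exact: proper_sub].
  have G0 : flat G && (G != set0).
    rewrite fG; apply: contraTneq rG => ->; have := rk_le_card (set0 : {set M}).
    by rewrite cards0; lia.
  exists (Sub G G0); rewrite ?SubK // inE SubK rG andbT properEneq sBG andbT.
  by apply: contraTneq rG => <-; lia.
(* The index becomes the dimension [j = m - l] of the intersection, which is the order of the
   falling factorial. *)
suff /(_ (m - l)%N (leq_subr _ _)) : forall j, (j <= m)%N ->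
    (c (m - j)%N)%:Z - increasing_weight (m - j) 1 m = 0.
  by rewrite subKn // => /eqP; rewrite subr_eq0 => /eqP.
apply: ffact_coef_unique => q.
under eq_bigr => j _ do rewrite mulrBl.
rewrite sumrB; apply/eqP; rewrite subr_eq0; apply/eqP.
transitivity ((2 * q).+1%:Z ^+ m).
  rewrite -(natz ((2 * q).+1)) -natrX natz -(count_points q fB).
  rewrite (big_morph _ PoszD (erefl _)).
  transitivity (\sum_(G : {set M} | flat G && (B \subset G)) \sum_(j < m.+1)
      if (n - rk G == j)%N then (2 ^ j * q ^_ j)%N%:Z else 0); last first.
    apply: eq_bigr => G /andP[fG sBG].
    have hj : (n - rk G < m.+1)%N by rewrite ltnS leq_sub2l // rk_mono.
    rewrite (bigD1 (Ordinal hj)) //= eqxx big1 ?addr0 // => j nj.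
    by case: eqP => // E; case/negP: nj; apply/eqP/val_inj.
  rewrite exchange_big /=; apply: eq_bigr => j _; rewrite -big_mkcondr /=.
  rewrite (eq_bigl (fun G => G \in [set G : {set M} |
      [&& flat G, B \subset G & rk G == rk B + (m - j)]%N])).
    by rewrite sumr_const -mulr_natl pmulrn intz.
  move=> G; rewrite inE -andbA; case fG: (flat G) => //; case sBG: (B \subset G) => //.
  have := rk_mono sBG; have := rk_le G; have := ltn_ord j; rewrite /m /=.
  by move: (rk G) (rk B) (nat_of_ord j) => x y z; lia.
rewrite -(increasing_weight_newton _ m 0) addn0 big_mkord.
rewrite (reindex_inj rev_ord_inj) /=; apply: eq_bigr => j _; rewrite subSS.
by have /= jm := ltn_ord j; rewrite subKn // -prod_odd_weight.
Qed.

End TypeBCount.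

Theorem theoremB (R : realType) (n : nat) (n_gt0 : (0 < n)%N) :
  is_chow_polynomial (typeB_matroid R n)
    (\sum_(t : n.-tuple 'I_n.+1 | admissible n (map val t))
       let a := map val t in
       (\prod_(1 <= i < n.+1) (2 * (entry a i)%:Z - 1))
         *: ('X ^+ des a * ('X + 1) ^+ (n - 1 - 2 * des a))).
Proof.
rewrite sum_admissible // => k.
exists (size (fy_mons #|typeB_matroid R n| (set0 : {set typeB_matroid R n}) k)).
  by apply: chow_piece_dim; apply: typeB_loopless.
have := @size_fy_mons (typeB_matroid R n) n (typeB_rk_full R n) (@typeB_card_flats R n)
  #|typeB_matroid R n| set0 k.
rewrite rk0 subn0.
by apply; [apply: flat0; apply: typeB_loopless | apply: max_card].
Qed.
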